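(* In the annotation model, for a graph stream of a connected undirected graph $G$ with $m$ edges and a designated root $s$, there is a valid $(m,1)$ protocol that accepts any valid augmented BFS transcript (rooted at $s$) and rejects, with probability at least $2/3$, any annotation that is not a valid augmented BFS transcript.
   Context: Annotation model: the stream of edges $E$ of $G=(V,E)$ (with $|V|=n$, $|E|=m$) is observed by a probabilistic verifier $\mathcal{V}$ (private random string, $w(m)$ machine words of working memory, each of $\Theta(\log m)$ bits) and a deterministic helper $\mathcal{H}$; afterwards $\mathcal{H}$ sends an annotation read by $\mathcal{V}$ as a stream; $\mathcal{V}$ accepts or outputs $\perp$. An $(h,v)$ protocol is valid with annotation length $O(h+1)$ (for a shortest valid annotation, maximized over inputs) and working memory $O(v+1)$ words. Label-augmented list of edges $E'$: preceded by a sorted list of all nodes $v$ each with a label $l(v)$ and claimed degree $\deg(v)$; each edge $e=(u,v)$ of $E'$ is annotated with symbols $l(e,u),l(e,v)$. It is valid if $l(e,u)=l(u)$, $l(e,v)=l(v)$ for all edges and $E'=E$ as multisets. BFS transcript rooted at $s$: a label-augmented list of edges $E'$ where each label $l(e,u)$ is claimed to be the distance from $s$ to $u$. Let $d_e=\min(l(e,u),l(e,v))$. It is valid if (a) edges are presented in increasing order of $d_e$; (b) $E'$ is a valid list of label-augmented edges; (c) for all $u$, $l(u)$ is the hop distance from $s$ to $u$. Let $E_l=\{e: d_e=l\}$ and $V_l=\{u:\exists e=(u,v),\ l(e,u)=l\}$. An augmented BFS transcript is a BFS transcript in which, before each $E_l$, the set $V_{l+1}$ is presented together with values $\deg_l(v)$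 claimed to equal $|\{u:(u,v)\in E, u\in V_l, v\in V_{l+1}\}|$. It is valid if the underlying BFS transcript is valid and all claimed values $\deg_l(v)$ are correct.
   Formalization: A valid label-augmented list is also required to have correct claimed degrees deg(v) in the node list; without this requirement no protocol with O(1) words exists, by the set-disjointness lower bound. *)

(* Defs.v *)
From mathcomp Require Import all_boot all_order all_algebra.
Set Implicit Arguments.
Unset Strict Implicit.
Unset Printing Implicit Defensive.

(* ---------- Graph streams ---------- *)

Definition undirected (p : nat * nat) : nat * nat :=
  (minn p.1 p.2, maxn p.1 p.2).

(* A connected simple undirected graph on the nodes 0, ..., n-1, a root, and
   the stream of its edges: every edge occurs exactly once, in an arbitrary
   order and orientation. *)
Record rooted_graph_stream := RootedGraphStream {
  gnodes : nat;
  gadj : rel 'I_gnodes;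
  groot : 'I_gnodes;
  gstream : seq ('I_gnodes * 'I_gnodes);
  gadj_sym : symmetric gadj;
  gadj_irr : irreflexive gadj;
  gadj_conn : forall u v, connect gadj u v;
  gstream_uniq :
    uniq [seq undirected (val p.1, val p.2) | p <- gstream];
  gstream_adj : forall u v,
    gadj u v = ((u, v) \in gstream) || ((v, u) \in gstream)
}.

Definition gedges (G : rooted_graph_stream) : nat := size (gstream G).

Definition hop_distance (T : finType) (e : rel T) (s u : T) (k : nat) : Prop :=
  (exists p : seq T, [/\ path e s p, last s p = u & size p = k]) /\
  (forall p : seq T, path e s p -> last s p = u -> k <= size p).

(* ---------- Annotations ---------- *)

(* The number of bits of a machine word.  It is Theta(log m); the shift by 2
   makes it positive for every m and lets 0, ..., m + 1 fit into one word. *)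
Definition word_size (m : nat) : nat := up_log 2 m.+2.

(* (v, l(v), deg(v)) *)
Definition node_entry : Type := nat * nat * nat.
(* (v, deg_l(v)) *)
Definition level_entry : Type := nat * nat.
(* ((u, l(e,u)), (v, l(e,v))) for e = (u,v) *)
Definition labelled_edge : Type := (nat * nat) * (nat * nat).

Inductive token :=
| NodeTok of node_entry
| LevelTok (* opens the next level: V_(l+1) with its values, then E_l *)
| LevelEntryTok of level_entry
| EdgeTok of labelled_edge.

Definition token_fields (t : token) : seq nat :=
  match t with
  | NodeTok (v, l, d) => [:: v; l; d]
  | LevelTok => [::]
  | LevelEntryTok (v, d) => [:: v; d]
  | EdgeTok ((u, lu), (v, lv)) => [:: u; lu; v; lv]
  end.

(* Arbitrary token sequences, ill-formed ones included, are annotations; every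
   field has to be a machine word. *)
Definition is_annotation (m : nat) (a : seq token) : bool :=
  all (fun t => all (fun x => x < 2 ^ word_size m) (token_fields t)) a.

(* Length in words; the constructor of a token is charged one word. *)
Definition annotation_length (a : seq token) : nat :=
  \sum_(t <- a) (size (token_fields t)).+1.

(* ---------- Verifiers ---------- *)

(* The verifier is told the number of nodes and the root at the start; it
   has to keep them in its working memory like any other data. *)
Inductive symbol :=
| ParamSym of nat & nat
| InputSym of nat & nat
| AnnotationSym of token.

Definition protocol_stream (G : rooted_graph_stream) (a : seq token) :
    seq symbol :=
  ParamSym (gnodes G) (groot G) ::
    [seq InputSym (val p.1) (val p.2) | p <- gstream G] ++ [seq AnnotationSym t | t <- a].

(* A one-pass machine whose entire memory consists of [vwords] machine words.
   The private random string is read once, [vcoins] bits per stream symbol, so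
   random bits that are to be reused have to be kept in the working memory. *)
Record verifier (m : nat) := Verifier {
  vwords : nat;
  vcoins : nat;
  vstart : vwords.-tuple 'I_(2 ^ word_size m);
  vstep : vwords.-tuple 'I_(2 ^ word_size m) -> symbol -> vcoins.-tuple bool ->
          vwords.-tuple 'I_(2 ^ word_size m);
  vaccept : vwords.-tuple 'I_(2 ^ word_size m) -> bool
}.

Definition random_string (m : nat) (V : verifier m) (xs : seq symbol) : finType :=
  (size xs).-tuple ((vcoins V).-tuple bool).

(* [false] stands for the output "bottom". *)
Definition output (m : nat) (V : verifier m) (xs : seq symbol)
    (r : random_string V xs) : bool :=
  vaccept (foldl (fun x z => vstep (v := V) x z.1 z.2) (vstart V) (zip xs r)).

Section Probability.
Local Open Scope ring_scope.

Definition accept_prob (m : nat) (V : verifier m) (xs : seq symbol) : rat :=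
  #|[set r : random_string V xs | output r]|%:R / #|random_string V xs|%:R.

Definition reject_prob (m : nat) (V : verifier m) (xs : seq symbol) : rat :=
  #|[set r : random_string V xs | ~~ output r]|%:R / #|random_string V xs|%:R.

(* An (h,v) protocol for recognising the annotations [valid]. *)
Definition valid_protocol
    (valid : rooted_graph_stream -> seq token -> Prop)
    (h v : nat -> nat) (P : forall m, verifier m) : Prop :=
  [/\ forall G a, is_annotation (gedges G) a -> valid G a ->
        accept_prob (P (gedges G)) (protocol_stream G a) = 1,
      forall G a, is_annotation (gedges G) a -> ~ valid G a ->
        2%:R / 3%:R <= reject_prob (P (gedges G)) (protocol_stream G a) &
      exists C : nat,
        (forall G, exists a, [/\ is_annotation (gedges G) a, valid G a &
           (annotation_length a <= C * (h (gedges G) + 1))%N]) /\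
        (forall m, (vwords (P m) <= C * (v m + 1))%N)].

End Probability.

(* ---------- Augmented BFS transcripts ---------- *)

Record transcript := Transcript {
  tnodes : seq node_entry;
  (* component l is the pair of the presentations of V_(l+1) and of E_l *)
  tlevels : seq (seq level_entry * seq labelled_edge)
}.

Definition tedges (T : transcript) : seq labelled_edge :=
  flatten [seq L.2 | L <- tlevels T].

Definition serialize (T : transcript) : seq token :=
  [seq NodeTok x | x <- tnodes T] ++
  flatten [seq LevelTok :: [seq LevelEntryTok x | x <- L.1] ++
                           [seq EdgeTok e | e <- L.2] | L <- tlevels T].

(* (v, l) \in endpoints E' iff some edge e of E' has endpoint v and
   l(e,v) = l *)
Definition endpoints (E' : seq labelled_edge) : seq (nat * nat) :=
  [seq e.1 | e <- E'] ++ [seq e.2 | e <- E'].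

Definition edge_depth (e : labelled_edge) : nat := minn e.1.2 e.2.2.

Definition edges_at (E' : seq labelled_edge) (l : nat) : seq labelled_edge :=
  [seq e <- E' | edge_depth e == l].

Definition nodes_at (E' : seq labelled_edge) (l : nat) : pred nat :=
  fun v => (v, l) \in endpoints E'.

(* The claimed degrees of the node list are part of what is verified. *)
Definition valid_labelled_edges (G : rooted_graph_stream)
    (N : seq node_entry) (E' : seq labelled_edge) : Prop :=
  [/\ [seq x.1.1 | x <- N] = iota 0 (gnodes G),
      forall (u : 'I_(gnodes G)) l d, (val u, l, d) \in N ->
        d = #|[set w | gadj u w]|,
      {subset endpoints E' <= [seq x.1 | x <- N]} &
      perm_eq [seq undirected (e.1.1, e.2.1) | e <- E']
              [seq undirected (val p.1, val p.2) | p <- gstream G]].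

Definition valid_bfs_transcript (G : rooted_graph_stream)
    (N : seq node_entry) (E' : seq labelled_edge) : Prop :=
  [/\ sorted leq [seq edge_depth e | e <- E'],
      valid_labelled_edges G N E' &
      forall (u : 'I_(gnodes G)) l d, (val u, l, d) \in N ->
        hop_distance (@gadj G) (groot G) u l].

Definition valid_augmented_transcript (G : rooted_graph_stream)
    (T : transcript) : Prop :=
  let E' := tedges T in
  valid_bfs_transcript G (tnodes T) E' /\
  forall l, l < size (tlevels T) ->
    let L := nth ([::], [::]) (tlevels T) l in
    [/\ L.2 = edges_at E' l, L.2 != [::],
        uniq [seq x.1 | x <- L.1],
        [seq x.1 | x <- L.1] =i nodes_at E' l.+1 &
        forall (v : 'I_(gnodes G)) d, (val v, d) \in L.1 ->
          d = #|[set u : 'I_(gnodes G) | gadj u v & nodes_at E' l u]|].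

Definition valid_augmented_bfs (G : rooted_graph_stream) (a : seq token) : Prop :=
  exists2 T, a = serialize T & valid_augmented_transcript G T.

(* Main.v *)
(** A transcript is checked while it streams by.  The format, the node numbering,
    the root label, the depth of every edge and the fact that the two labels of
    an edge differ by at most one are verified directly.  What remains amounts
    to four multiset identities: the edges of E' are those of the stream; the
    pairs (v, l(v)), taken deg(v) times, are the endpoints of E'; the pairs
    (v, l+1), taken deg_l(v) times, are the lower endpoints of the edges between
    consecutive levels; and the pairs (v, l+1) presented with the levels are the
    pairs (v, l(v)) of the nodes other than the root, once each.  Together with
    deg_l(v) > 0, the third identity gives every node at level l+1 a neighbour
    at level l, so the labels are the distances.  The four identities are tested
    at once by comparing the products of r - x over the two multisets, at a
    random point r of a field with 2^(16 w) elements for words of w bits. *)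
Require Import Defs.
From mathcomp Require Import all_boot all_order all_algebra all_field.
From mathcomp Require Import zify.
Set Implicit Arguments.
Unset Strict Implicit.
Unset Printing Implicit Defensive.
Import Order.TTheory GRing.Theory Num.Theory.

Local Notation no_level := (@nil level_entry, @nil labelled_edge).
Local Notation level_list := (seq (seq level_entry * seq labelled_edge)).

(** * Distances and degrees *)

Lemma hop_distance_inj (T : finType) (e : rel T) (s u : T) j k :
  hop_distance e s u j -> hop_distance e s u k -> j = k.
Proof.
move=> [[p [ep lp <-]] minp] [[q [eq lq <-]] minq].
by apply/eqP; rewrite eqn_leq minp // minq.
Qed.

Lemma hop_distance0 (T : finType) (e : rel T) (s u : T) k :
  hop_distance e s u k -> (k == 0) = (u == s).
Proof.
move=> [[p [ep lp <-]] minp]; apply/eqP/eqP => [/size0nil p0|us].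
  by rewrite -lp p0.
by have := minp [::] isT (esym us); case: (p).
Qed.

Lemma hop_distance_step (T : finType) (e : rel T) (s u v : T) j k :
  hop_distance e s u j -> hop_distance e s v k -> e u v -> k <= j.+1.
Proof.
move=> [[p [ep lp <-]] _] [_ minv] euv.
by rewrite -(size_rcons p v) minv ?last_rcons // rcons_path ep lp.
Qed.

(** Cut the last edge off a shortest path: a shorter path to [u] would extend to a shorter one to
    [v]. *)
Lemma hop_distance_pred (T : finType) (e : rel T) (s v : T) k :
  hop_distance e s v k.+1 -> exists2 u, e u v & hop_distance e s u k.
Proof.
move=> [[p]]; case/lastP: p => [|p w] [//]; rewrite rcons_path last_rcons size_rcons.
move=> /andP[ep epw] wv [pk] minv; rewrite {}wv in epw.
exists (last s p) => //; split; first by exists p.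
move=> q eq lq; rewrite -ltnS -(size_rcons q v) minv ?last_rcons //.
by rewrite rcons_path eq lq.
Qed.

(** A local certificate for distances. The bound along edges makes every path to [v] at least [f v]
    long; walking back through the promised neighbours, each lowering [f] by one, gives a path of
    exactly that length. *)
Lemma hop_distanceP (T : finType) (e : rel T) (s : T) (f : T -> nat) :
  f s = 0 -> (forall u v, e u v -> f v <= (f u).+1) ->
  (forall v, v != s -> exists2 u, e u v & f v = (f u).+1) ->
  forall v, hop_distance e s v (f v).
Proof.
move=> f0 f1 fpred v; split; last first.
  move=> p; elim/last_ind: p v => [|p w IHp] v.
    by move=> _ <- /=; rewrite f0.
  rewrite rcons_path last_rcons size_rcons => /andP[ep /f1 fw] <-.
  by rewrite (leq_trans fw) // ltnS IHp.
move: {2}(f v) (erefl (f v)) => k; elim: k v => [|k IHk] v fv.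
  have [->|/fpred[u _]] := eqVneq v s; first by exists [::]; rewrite f0.
  by rewrite fv.
have [vs|/fpred[u euv fvu]] := eqVneq v s; first by rewrite vs f0 in fv.
have fu : f u = k by rewrite fv in fvu; case: fvu.
have [p [ep lp sp]] := IHk u fu; exists (rcons p v).
by rewrite rcons_path last_rcons size_rcons ep lp sp fu -fv.
Qed.

Lemma hop_distance_ex (T : finType) (e : rel T) (s : T) :
  (forall u, connect e s u) -> exists f, forall u, hop_distance e s u (f u).
Proof.
move=> conn; suff /fin_all_exists[f fP] : forall u, exists k, hop_distance e s u k.
  by exists f.
move=> u.
pose P k := [exists p : k.-tuple T, path e s p && (last s p == u)].
have exP : exists k, P k.
  have /connectP[p ep lp] := conn u; exists (size p); apply/existsP.
  by exists (in_tuple p); rewrite /= ep lp eqxx.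
exists (ex_minn exP); case: ex_minnP => k /existsP[p /andP[ep /eqP lp]] mink.
split; first by exists p; rewrite size_tuple.
move=> q eq lq; apply: mink; apply/existsP; exists (in_tuple q).
by rewrite /= eq lq eqxx.
Qed.

Lemma undirected_eq (a b c d : nat) :
  (undirected (a, b) == undirected (c, d)) =
  ((a, b) == (c, d)) || ((a, b) == (d, c)).
Proof.
by rewrite /undirected /= !xpair_eqE; apply/idP/idP; lia.
Qed.

Section Graph.
Variable G : rooted_graph_stream.
Local Notation V := 'I_(gnodes G).
Implicit Types (u v w : V).

Definition stream_edges : seq (nat * nat) :=
  [seq undirected (val p.1, val p.2) | p <- gstream G].

Lemma mem_stream_edges u v :
  (undirected (val u, val v) \in stream_edges) = gadj u v.
Proof.
rewrite gstream_adj; apply/mapP/orP => [[[a b] abG /eqP]|[|]].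
- rewrite undirected_eq /= !xpair_eqE !val_eqE.
  by case/orP => /andP[/eqP-> /eqP->]; [left|right].
- by exists (u, v).
- by exists (v, u) => //; apply/eqP; rewrite undirected_eq eqxx orbT.
Qed.

(** Double counting with a weight on the far endpoint: weight 1 yields degrees, the indicator of a
    label yields the values deg_l. A neighbour is counted once because no undirected edge is
    repeated in the stream. *)
Lemma handshake v (h : nat -> nat) :
  \sum_(p <- gstream G)
    ((val p.1 == v) * h (val p.2) + (val p.2 == v) * h (val p.1)) =
  \sum_(w : V | gadj v w) h w.
Proof.
pose N (p : V * V) w := (p == (v, w)) + (p == (w, v)).
have E (p : V * V) : (val p.1 == v) * h (val p.2) + (val p.2 == v) * h (val p.1) =
           \sum_(w : V) h w * N p w.
  rewrite /N; under [RHS]eq_bigr do rewrite mulnDr.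
  case: p => a b /=; rewrite big_split /= (bigD1 b) // [X in _ = _ + X](bigD1 a) //=.
  rewrite !big1 => [|w wb|w wb]; first by rewrite !xpair_eqE !eqxx andbT !addn0 !val_eqE ![h _ * _]mulnC.
    by rewrite xpair_eqE [a == w]eq_sym (negPf wb) muln0.
  by rewrite xpair_eqE [b == w]eq_sym (negPf wb) andbF muln0.
rewrite (eq_bigr _ (fun p _ => E p)) exchange_big [RHS]big_mkcond /=.
apply: eq_bigr => w _; rewrite -big_distrr /=.
(* For [w = v] irreflexivity makes the sum vanish; for [w != v] the two orientations in [N] exclude
   each other, so the sum is the multiplicity of one normalised edge. *)
have [vw|vw] := eqVneq v w.
  rewrite -vw gadj_irr big1_seq ?muln0 // => p /andP[_ pG]; rewrite /N.
  case: eqP pG => [-> vG|//]; suff: gadj v v by rewrite gadj_irr.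
  by rewrite gstream_adj vG.
have -> : \sum_(p <- gstream G) N p w = count_mem (undirected (val v, val w)) stream_edges.
  rewrite /stream_edges count_map -sum1_count [RHS]big_mkcond.
  apply: eq_bigr => -[a b] _; rewrite /N /= undirected_eq !xpair_eqE !val_eqE.
  by have [->|] := eqVneq a v; rewrite ?(negPf vw) /= ?orbF; do ?case: (_ == _).
rewrite (count_uniq_mem _ (gstream_uniq G)) mem_stream_edges.
by case: gadj; rewrite ?muln1 ?muln0.
Qed.

(** The summand is symmetric in the two ends of an edge, so only the multiset of normalised edges
    matters. *)
Lemma handshake_perm v (h : nat -> nat) (E' : seq (nat * nat)) :
  perm_eq [seq undirected e | e <- E'] stream_edges ->
  \sum_(e <- E') ((e.1 == v) * h e.2 + (e.2 == v) * h e.1) =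
  \sum_(w : V | gadj v w) h w.
Proof.
move=> E'G; pose g (e : nat * nat) := (e.1 == v) * h e.2 + (e.2 == v) * h e.1.
have gU e : g (undirected e) = g e.
  by case: e => a b; rewrite /g /undirected /=; case: (leqP a b) => // _; rewrite addnC.
rewrite -handshake.
transitivity (\sum_(e <- [seq undirected e | e <- E']) g e).
  by rewrite big_map; under [RHS]eq_bigr do rewrite gU.
rewrite (perm_big _ E'G) /stream_edges big_map.
by apply: eq_bigr => p _; rewrite gU.
Qed.

(** By connectedness, every node but the root is the deeper end of a stream edge, namely one to a
    neighbour closer to the root. *)
Lemma gnodes_leq : gnodes G <= (gedges G).+1.
Proof.
have [f fP] := hop_distance_ex (gadj_conn (groot G)).
pose deeper (p : V * V) := if f p.1 < f p.2 then p.2 else p.1.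
rewrite -[gnodes G]size_enum_ord /gedges -(size_map deeper) -/(size (groot G :: _)).
apply: uniq_leq_size (enum_uniq _) _ => v _; rewrite inE.
have [//|vs] := eqVneq v _; case fv: (f v) => [|k].
  by move: (hop_distance0 (fP v)); rewrite fv (negPf vs) eqxx.
move: (fP v); rewrite fv => /hop_distance_pred[u euv /hop_distance_inj/(_ (fP u)) ku].
apply/mapP; move: euv; rewrite gstream_adj => /orP[]; [exists (u, v)|exists (v, u)];
  by rewrite // /deeper /= fv ku ?ltnSn // ltnNge leqnSn.
Qed.

End Graph.

(** * Labelled edges and levels *)

Definition deeper_ends (e : labelled_edge) : seq (nat * nat) :=
  (if e.1.2 == e.2.2.+1 then [:: e.1] else [::]) ++
  (if e.2.2 == e.1.2.+1 then [:: e.2] else [::]).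

(** A claimed number becomes a multiplicity, so that its correctness turns into an equality of
    multisets. *)
Definition copies (s : seq node_entry) : seq (nat * nat) :=
  flatten [seq nseq x.2 x.1 | x <- s].


(* The entry (v, d) presented with V_(k+1) becomes (v, k+1, d). *)
Definition level_entries (Ls : level_list) : seq node_entry :=
  flatten [seq [seq (x.1, k.+1, x.2) | x <- (nth ([::], [::]) Ls k).1]
          | k <- iota 0 (size Ls)].

Lemma count_copies (s : seq node_entry) (p : pred (nat * nat)) :
  count p (copies s) = \sum_(x <- s) x.2 * p x.1.
Proof.
rewrite /copies count_flatten -map_comp sumnE big_map.
by apply: eq_bigr => x _; rewrite /= count_nseq mulnC.
Qed.

Lemma count_copies_mem (s : seq node_entry) x :
  uniq [seq y.1 | y <- s] -> x \in s -> count_mem x.1 (copies s) = x.2.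
Proof.
move=> Us xs; rewrite count_copies (big_rem x) //= eqxx muln1.
rewrite big1_seq ?addn0 // => y /andP[_ ys]; case: eqP => yx; rewrite ?muln0 //.
have := Us; rewrite (perm_uniq (perm_map _ (perm_to_rem xs))) /= -yx.
by rewrite (map_f _ ys).
Qed.

Lemma mem_copies (s : seq node_entry) y :
  y \in copies s -> exists2 x, x \in s & x.1 = y.
Proof.
case/flattenP=> t /mapP[x xs ->]; rewrite mem_nseq => /andP[_ /eqP->].
by exists x.
Qed.

Lemma mem_copies_pos (s : seq node_entry) x :
  x \in s -> 0 < x.2 -> x.1 \in copies s.
Proof.
move=> xs x0; apply/flattenP; exists (nseq x.2 x.1); first exact: map_f.
by rewrite mem_nseq x0 eqxx.
Qed.

Lemma mem_level_entries (Ls : level_list) v l d :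
  reflect (exists k, [/\ k < size Ls, l = k.+1 & (v, d) \in (nth ([::], [::]) Ls k).1])
          ((v, l, d) \in level_entries Ls).
Proof.
apply: (iffP flattenP) => [[t /mapP[k]]|[k [kL -> vd]]].
  rewrite mem_iota /= add0n => kL -> /mapP[[v' d'] vd [-> -> ->]].
  by exists k.
exists [seq (x.1, k.+1, x.2) | x <- (nth ([::], [::]) Ls k).1].
  by apply: map_f; rewrite mem_iota.
by apply/mapP; exists (v, d).
Qed.

Lemma level_entries_rcons (Ls : level_list) L :
  level_entries (rcons Ls L) =
  level_entries Ls ++ [seq (x.1, (size Ls).+1, x.2) | x <- L.1].
Proof.
rewrite /level_entries size_rcons -addn1 iotaD map_cat flatten_cat /= cats0 add0n.
rewrite nth_rcons ltnn eqxx; rewrite addn1; congr (flatten _ ++ _).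
apply/eq_in_map => k; rewrite mem_iota /= add0n => kL.
by rewrite nth_rcons kL.
Qed.

Lemma mem_deeper_ends e y : y \in deeper_ends e -> (y == e.1) || (y == e.2).
Proof.
rewrite /deeper_ends mem_cat; do 2!case: ifP => _; rewrite ?inE //= ?orbF => -> //.
by rewrite orbT.
Qed.

Section Levels.
Variable (Ls : level_list).
Local Notation E' := (flatten [seq L.2 | L <- Ls]).

Hypothesis depths :
  forall k, k < size Ls -> all (fun e => edge_depth e == k) (nth no_level Ls k).2.

(** Since block [k] holds edges of depth [k] only, filtering the concatenation by depth erases every
    other block. *)
Lemma edges_at_level k : k < size Ls -> edges_at E' k = (nth no_level Ls k).2.
Proof.
rewrite /edges_at; elim/last_ind: Ls depths => [//|Ls' L IH] dep.
have dep' j : j < size Ls' -> all (fun e => edge_depth e == j) (nth no_level Ls' j).2.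
  by move=> jL; have := dep j; rewrite size_rcons nth_rcons jL => -> //; apply: ltnW.
have depL : all (fun e => edge_depth e == size Ls') L.2.
  by have := dep (size Ls'); rewrite size_rcons nth_rcons ltnn eqxx; apply.
rewrite size_rcons ltnS leq_eqVlt map_rcons flatten_rcons filter_cat nth_rcons.
case/predU1P => [->|kL]; last first.
  rewrite kL IH // -[RHS]cats0; congr (_ ++ _); apply/eqP; rewrite -size_eq0.
  rewrite size_filter -leqn0 leqNgt -has_count; apply/hasPn => e eL.
  by rewrite (eqP (allP depL e eL)) gtn_eqF.
rewrite ltnn eqxx (all_filterP depL) -[RHS]cat0s; congr (_ ++ _).
apply/eqP; rewrite -size_eq0 size_filter -leqn0 leqNgt -has_count.
apply/hasPn => e /flattenP[t /mapP[M /(nthP no_level)[j jL <-] ->]] et.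
by rewrite (eqP (allP (dep' j jL) e et)) ltn_eqF.
Qed.

Lemma sorted_depths : sorted leq [seq edge_depth e | e <- E'].
Proof.
rewrite sorted_pairwise; last exact: leq_trans.
elim/last_ind: Ls depths => [//|Ls' L IH] dep.
have dep' j : j < size Ls' -> all (fun e => edge_depth e == j) (nth no_level Ls' j).2.
  by move=> jL; have := dep j; rewrite size_rcons nth_rcons jL => -> //; apply: ltnW.
have depL : all (fun e => edge_depth e == size Ls') L.2.
  by have := dep (size Ls'); rewrite size_rcons nth_rcons ltnn eqxx; apply.
rewrite map_rcons flatten_rcons map_cat pairwise_cat IH //=.
apply/andP; split.
  apply/allrelP => x y /mapP[e eL' ->] /mapP[f fL ->].
  rewrite (eqP (allP depL f fL)).
  case/flattenP: eL' => t /mapP[M /(nthP no_level)[j jL <-] ->] et.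
  by rewrite (eqP (allP (dep' j jL) e et)) ltnW.
rewrite -sorted_pairwise; last exact: leq_trans.
(* The depths in the last block are constant; prefixing them with their common value makes every
   comparison, the first included, one of equal numbers. *)
apply: (@path_sorted _ _ (size Ls')); apply/(pathP 0) => i.
rewrite size_map => iL.
have H j : j < size L.2 -> nth 0 [seq edge_depth e | e <- L.2] j = size Ls'.
  move=> jL; rewrite (nth_map (0,0,(0,0))) //.
  by apply/eqP/(allP depL)/mem_nth.
by rewrite H //; case: i iL => [|i] iL //=; rewrite H // ltnW.
Qed.

End Levels.

Section Labelled.
Variables (G : rooted_graph_stream) (N : seq node_entry) (E' : seq labelled_edge).
Local Notation V := 'I_(gnodes G).
Implicit Types (u v w : V).

Hypothesis nodesN : [seq x.1.1 | x <- N] = iota 0 (gnodes G).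

(** The nodes are listed in numerical order, so node [v] is entry number [v]; the default is never
    reached for a node of the graph. *)
Definition label (v : nat) : nat := (nth (0, 0, 0) N v).1.2.
Definition claimed_degree (v : nat) : nat := (nth (0, 0, 0) N v).2.

Lemma size_nodes : size N = gnodes G.
Proof. by rewrite -(size_map (fun x => x.1.1)) nodesN size_iota. Qed.

Lemma mem_nodes v l d :
  (val v, l, d) \in N = (l == label v) && (d == claimed_degree v).
Proof.
have nthN i : i < gnodes G -> (nth (0, 0, 0) N i).1.1 = i.
  move=> iG; rewrite -(nth_map _ 0 (fun x => x.1.1)) ?size_nodes // nodesN.
  by rewrite nth_iota.
apply/(nthP (0, 0, 0))/andP => [[i]|[/eqP-> /eqP->]].
  rewrite size_nodes => iG Ni; have := nthN i iG; rewrite Ni /= => vi.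
  by rewrite /label /claimed_degree vi Ni.
exists v; rewrite ?size_nodes //; move: (nthN v (ltn_ord v)).
by rewrite /label /claimed_degree; case: nth => -[a b] c /= ->.
Qed.

Lemma mem_nodes_ord x : x \in N -> exists v, x = (val v, label v, claimed_degree v).
Proof.
move=> xN; have xG : x.1.1 < gnodes G.
  by have := map_f (fun x => x.1.1) xN; rewrite nodesN mem_iota.
exists (Ordinal xG); move: xN; case: x xG => -[v l] d /= xG.
by rewrite -[v]/(val (Ordinal xG)) mem_nodes => /andP[/eqP-> /eqP->].
Qed.

Lemma mem_node_pairs y :
  reflect (exists v, y = (val v, label v)) (y \in [seq x.1 | x <- N]).
Proof.
apply: (iffP mapP) => [[x /mem_nodes_ord[v ->] ->]|[v ->]]; first by exists v.
by exists (val v, label v, claimed_degree v); rewrite ?mem_nodes ?eqxx.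
Qed.

Lemma uniq_node_pairs : uniq [seq x.1 | x <- N].
Proof.
by apply: (@map_uniq _ _ fst); rewrite -map_comp nodesN iota_uniq.
Qed.

Hypothesis endpointsN : {subset endpoints E' <= [seq x.1 | x <- N]}.
Hypothesis edgesE :
  perm_eq [seq undirected (e.1.1, e.2.1) | e <- E'] (stream_edges G).

Lemma mem_edge e : e \in E' ->
  exists u w, e = ((val u, label u), (val w, label w)) /\ gadj u w.
Proof.
move=> eE.
have /endpointsN/mem_node_pairs[u e1] : e.1 \in endpoints E'.
  by rewrite /endpoints mem_cat map_f.
have /endpointsN/mem_node_pairs[w e2] : e.2 \in endpoints E'.
  by rewrite /endpoints mem_cat [X in _ || X]map_f ?orbT.
exists u, w; rewrite -e1 -e2 -surjective_pairing; split=> //.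
rewrite -mem_stream_edges -(perm_mem edgesE).
by apply/mapP; exists e; rewrite ?e1 ?e2.
Qed.

Lemma adj_edge u w : gadj u w ->
  ((val u, label u), (val w, label w)) \in E' \/
  ((val w, label w), (val u, label u)) \in E'.
Proof.
rewrite -mem_stream_edges -(perm_mem edgesE) => /mapP[e eE /eqP].
have [a [b [ee _]]] := mem_edge eE.
rewrite undirected_eq ee /= !xpair_eqE !val_eqE.
by case/orP=> /andP[/eqP-> /eqP->]; rewrite -ee; [left | right].
Qed.

Lemma mem_endpoints y : y \in endpoints E' -> exists v, y = (val v, label v).
Proof. by move/endpointsN/mem_node_pairs. Qed.

(** [nodes_at] sees a node only through its edges; the neighbour [w] supplies one. *)
Lemma nodes_at_adj u w l : gadj u w -> nodes_at E' l u = (l == label u).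
Proof.
move=> uw; rewrite /nodes_at; apply/idP/eqP => [/mem_endpoints[v []]|->].
  by move/val_inj->.
case: (adj_edge uw) => uwE; rewrite /endpoints mem_cat; apply/orP;
  [left|right]; by apply/mapP; eexists; first exact: uwE.
Qed.

Lemma mem_deeper y :
  y \in flatten [seq deeper_ends e | e <- E'] ->
  y \in endpoints E' /\ exists v, y = (val v, label v).
Proof.
case/flattenP=> t /mapP[e eE ->] /mem_deeper_ends ye.
suff yE : y \in endpoints E' by split=> //; apply: mem_endpoints.
by rewrite /endpoints mem_cat; case/orP: ye => /eqP->; rewrite map_f ?orbT.
Qed.

Lemma count_endpoints v :
  count_mem (val v, label v) (endpoints E') = #|[set w | gadj v w]|.
Proof.
rewrite cardsE -sum1_card -[RHS](handshake_perm v (fun _ => 1)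
  (E' := [seq (e.1.1, e.2.1) | e <- E'])) -?map_comp // big_map big_split /=.
rewrite /endpoints count_cat !count_map -!sum1_count /=.
congr (_ + _); rewrite big_mkcond /=; apply: eq_big_seq => e /mem_edge[a [b [-> _]]];
  rewrite muln1 xpair_eqE !val_eqE; by case: eqP => [->|]; rewrite ?eqxx.
Qed.

(** The handshake identity, weighted by the indicator that the far endpoint has a label one smaller
    than that of [v]. *)
Lemma count_deeper v :
  count_mem (val v, label v) (flatten [seq deeper_ends e | e <- E']) =
  #|[set u | gadj u v & (label u).+1 == label v]|.
Proof.
have -> : #|[set u | gadj u v & (label u).+1 == label v]| =
          \sum_(u : V | gadj v u) ((label u).+1 == label v).
  rewrite cardsE -sum1_card big_mkcondr /=.
  by apply: eq_big => [u|u _]; [rewrite gadj_sym | case: eqP].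
rewrite -(handshake_perm v (fun x => (label x).+1 == label v : nat)
  (E' := [seq (e.1.1, e.2.1) | e <- E'])) -?map_comp // big_map.
rewrite count_flatten -map_comp sumnE big_map.
apply: eq_big_seq => e /mem_edge[a [b [-> _]]] /=; rewrite /deeper_ends /= count_cat.
congr (_ + _).
  have [->|av] := eqVneq (val a) v; last by case: ifP; rewrite //= xpair_eqE (negPf av).
  by rewrite eq_sym; case: ifP; rewrite //= eqxx.
have [->|bv] := eqVneq (val b) v; last by case: ifP; rewrite //= xpair_eqE (negPf bv).
by rewrite eq_sym; case: ifP; rewrite //= eqxx.
Qed.

End Labelled.

(** * The checks characterise valid transcripts *)

Definition edge_ok (k : nat) (e : labelled_edge) : bool :=
  (edge_depth e == k) && (maxn e.1.2 e.2.2 <= k.+1).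

(** A value 0 would leave no copy of its node in the third multiset identity and so escape it; hence
    the positivity test. *)
Definition level_ok (k : nat) (L : seq level_entry * seq labelled_edge) : bool :=
  all (edge_ok k) L.2 && all (fun x => 0 < x.2) L.1.

Definition root_label_ok (s : nat) (x : node_entry) : bool :=
  (x.1.1 == s) ==> (x.1.2 == 0).

Definition locally_valid (G : rooted_graph_stream) (T : transcript) : Prop :=
  [/\ [seq x.1.1 | x <- tnodes T] = iota 0 (gnodes G),
      all (root_label_ok (groot G)) (tnodes T) &
      forall k, k < size (tlevels T) ->
        level_ok k (nth no_level (tlevels T) k) /\ (nth no_level (tlevels T) k).2 != [::]].

Definition multisets_match (G : rooted_graph_stream) (T : transcript) : Prop :=
  [/\ perm_eq (stream_edges G) [seq undirected (e.1.1, e.2.1) | e <- tedges T],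
      perm_eq (copies (tnodes T)) (endpoints (tedges T)),
      perm_eq (copies (level_entries (tlevels T)))
              (flatten [seq deeper_ends e | e <- tedges T]) &
      perm_eq [seq x.1 | x <- level_entries (tlevels T)]
              [seq x.1 | x <- tnodes T & x.1.1 != groot G :> nat]].

Section Transcript.
Variables (G : rooted_graph_stream) (T : transcript).
Local Notation V := 'I_(gnodes G).
Local Notation N := (tnodes T).
Local Notation Ls := (tlevels T).
Local Notation E' := (tedges T).
Local Notation lab := (label N).
Implicit Types (u v w : V).

Lemma level_depths : (forall k, k < size Ls -> level_ok k (nth no_level Ls k)) ->
  forall k, k < size Ls -> all (fun e => edge_depth e == k) (nth no_level Ls k).2.
Proof.
move=> ok k /ok/andP[/allP eok _]; apply/allP => e /eok; by case/andP.
Qed.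

(** The labels satisfy the certificate [hop_distanceP], and the multiset identities turn the claimed
    degrees and the values deg_l into counts of endpoints. *)
Lemma locally_valid_sound :
  locally_valid G T -> multisets_match G T -> valid_augmented_transcript G T.
Proof.
move=> [nodesN rootN levelsL] [edgesE copiesN copiesL pairsL].
have {}edgesE : perm_eq [seq undirected (e.1.1, e.2.1) | e <- E'] (stream_edges G).
  by rewrite perm_sym.
have endN : {subset endpoints E' <= [seq x.1 | x <- N]}.
  move=> y; rewrite -(perm_mem copiesN) => /mem_copies[x xN <-]; exact: map_f.
have depths := level_depths (fun k kL => (levelsL k kL).1).
have memE := mem_edge nodesN endN edgesE.
have root0 : lab (groot G) = 0.
  have /(allP rootN) : (val (groot G), lab (groot G), claimed_degree N (groot G)) \in N.
    by rewrite (mem_nodes nodesN) !eqxx.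
  by rewrite /root_label_ok eqxx => /eqP.
(* The fourth identity, read as membership. *)
have mem_pairs v l : ((val v, l) \in [seq x.1 | x <- level_entries Ls]) =
                     (l == lab v) && (v != groot G).
  rewrite (perm_mem pairsL); apply/mapP/andP => [[x]|[/eqP-> vs]].
    rewrite mem_filter => /andP[xs /(mem_nodes_ord nodesN)[w xw]].
    rewrite xw in xs * => -[vw ->]; rewrite vw eqxx; split=> //.
    by apply: contraNneq xs => <-; rewrite vw.
  exists (val v, lab v, claimed_degree N v) => //.
  by rewrite mem_filter vs (mem_nodes nodesN) !eqxx.
have entry_pos x : x \in level_entries Ls -> 0 < x.2.
  case: x => -[v l] d /mem_level_entries[k [kL _ vd]].
  by have [/andP[_ /allP/(_ _ vd)]] := levelsL k kL.
have uniqL : uniq [seq x.1 | x <- level_entries Ls].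
  rewrite (perm_uniq pairsL); apply: subseq_uniq (uniq_node_pairs nodesN).
  exact/map_subseq/filter_subseq.
have labels_step e : e \in E' -> e.1.2 <= e.2.2.+1 /\ e.2.2 <= e.1.2.+1.
  case/flattenP=> t /mapP[L /(nthP no_level)[k kL <-] ->] et.
  have [/andP[/allP/(_ _ et)/andP[/eqP dk mk] _] _] := levelsL k kL.
  by case: e dk mk {et} => -[a la] [b lb]; rewrite /edge_depth /= => dk mk; split; lia.
(* [labels_step] bounds the labels along edges. A node other than the root is presented with a
   level, has a positive value there, and so is the deeper end of an edge whose other end is the
   required neighbour. *)
have distG v : hop_distance (@gadj G) (groot G) v (lab v).
  apply: (hop_distanceP (f := fun v => lab (val v))) => // [u w uw|w ws].
    by case: (adj_edge nodesN endN edgesE uw) => /labels_step[].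
  have /mapP[x xL wx] : (val w, lab w) \in [seq x.1 | x <- level_entries Ls].
    by rewrite mem_pairs eqxx ws.
  have : x.1 \in flatten [seq deeper_ends e | e <- E'].
    by rewrite -(perm_mem copiesL) mem_copies_pos // entry_pos.
  rewrite -wx => /flattenP[t /mapP[e eE ->]].
  have [a [b [-> ab]]] := memE e eE.
  rewrite /deeper_ends /= mem_cat; case/orP; case: eqP => //= lab_ab;
    rewrite inE => /eqP[/val_inj->] _; first by exists b; rewrite // gadj_sym.
  by exists a.
split; first split=> //.
- exact: sorted_depths depths.
- split=> // v l d; rewrite (mem_nodes nodesN) => /andP[_ /eqP->].
  rewrite -(count_endpoints nodesN endN edgesE) -(permP copiesN).
  have vN : (val v, lab v, claimed_degree N v) \in N by rewrite (mem_nodes nodesN) !eqxx.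
  by rewrite (count_copies_mem (uniq_node_pairs nodesN) vN).
- by move=> v l d; rewrite (mem_nodes nodesN) => /andP[/eqP-> _].
move=> k kL; rewrite /= edges_at_level //.
have [/andP[_ /allP posL] nilL] := levelsL k kL; split=> //.
(* The entries of one level form a contiguous block of [level_entries], whose pairs are distinct. *)
- have -> : [seq x.1 | x <- (nth no_level Ls k).1] =
    [seq y.1 | y <- [seq (x.1, k.+1) | x <- (nth no_level Ls k).1]].
    by rewrite -map_comp.
  rewrite map_inj_in_uniq => [|y z /mapP[y' _ ->] /mapP[z' _ ->] /= -> //].
  apply: subseq_uniq uniqL; rewrite /level_entries map_flatten -map_comp.
  rewrite -(cat_take_drop k (iota _ _)) (drop_nth 0) ?size_iota // nth_iota // add0n.
  rewrite map_cat flatten_cat /= -map_comp.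
  by apply: subseq_trans (suffix_subseq _ _); apply: prefix_subseq.
- move=> v; have keyP : (v \in [seq x.1 | x <- (nth no_level Ls k).1]) =
      ((v, k.+1) \in [seq x.1 | x <- level_entries Ls]).
    apply/mapP/mapP => [[[w d] wd ->]|[[[w l] d] /mem_level_entries[j [jL -> wd]]]] /=.
      by exists (w, k.+1, d) => //; apply/mem_level_entries; exists k.
    by move=> [-> kj]; exists (w, d); rewrite // kj.
  rewrite keyP /nodes_at unfold_in; apply/idP/idP => [vL|vE].
    case/mapP: vL => x xL vx.
    have : x.1 \in flatten [seq deeper_ends e | e <- E'].
      by rewrite -(perm_mem copiesL) mem_copies_pos // entry_pos.
    by rewrite -vx => /(mem_deeper nodesN endN)[].
  have [w [vw kw]] := mem_endpoints nodesN endN vE.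
  rewrite vw mem_pairs kw eqxx /=; apply/eqP => ws.
  by move: kw; rewrite ws root0.
- move=> v d vd; have vL : (val v, k.+1, d) \in level_entries Ls.
    by apply/mem_level_entries; exists k.
  have := count_copies_mem uniqL vL; rewrite (permP copiesL) /=.
  have : (val v, k.+1) \in [seq x.1 | x <- level_entries Ls] by apply/mapP; exists (val v, k.+1, d).
  rewrite mem_pairs => /andP[/eqP kv _].
  rewrite {1}kv (count_deeper nodesN endN edgesE) => <-.
  apply: eq_card => u; rewrite !inE; case: (boolP (gadj u v)) => //= uv.
  by rewrite (nodes_at_adj nodesN endN edgesE _ uv) -kv eqSS eq_sym.
Qed.

(** * Valid transcripts pass all checks *)

Section Completeness.
Hypothesis T_valid : valid_augmented_transcript G T.

(** Labels are now distances, so they differ by at most one along edges and every node other than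
    the root has a neighbour one step closer. The identities follow by comparing the multiplicities
    of each pair. *)
Lemma valid_locally_valid : locally_valid G T /\ multisets_match G T.
Proof.
have [[_ [nodesN degN endN edgesE] distN] levelsL] := T_valid.
have memE := mem_edge nodesN endN edgesE.
have distG v : hop_distance (@gadj G) (groot G) v (lab v).
  by apply: (distN v _ (claimed_degree N v)); rewrite (mem_nodes nodesN) !eqxx.
have root0 : lab (groot G) = 0 by apply/eqP; rewrite (hop_distance0 (distG _)).
have parent v k : lab v = k.+1 -> exists2 u, gadj u v & lab u = k.
  move=> vk; have := distG v; rewrite vk => /hop_distance_pred[u uv du].
  by exists u => //; apply: hop_distance_inj du.
have endE v : v != groot G -> exists2 u, gadj u v & (lab u).+1 = lab v.
  move=> vs; case vk : (lab v) => [|k].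
    by move/eqP: vk; rewrite (hop_distance0 (distG v)) (negPf vs).
  by have [u uv <-] := parent _ _ vk; exists u.
have depth_size e : e \in E' -> edge_depth e < size Ls.
  case/flattenP=> t /mapP[L /(nthP no_level)[k kL <-] ->].
  by have [/= -> _ _ _ _] := levelsL k kL; rewrite mem_filter => /andP[/eqP-> _].
have keyP k (v : nat) : k < size Ls ->
    (v \in [seq x.1 | x <- (nth no_level Ls k).1]) = ((v, k.+1) \in endpoints E').
  by move=> kL; have [_ _ _ -> _] := levelsL k kL.
have entry_deg v k d : k < size Ls -> (val v, d) \in (nth no_level Ls k).1 ->
    k.+1 = lab v /\ d = #|[set u | gadj u v & (lab u).+1 == lab v]|.
  move=> kL vd; have : (val v, k.+1) \in endpoints E'.
    by rewrite -keyP //; apply/mapP; exists (val v, d).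
  case/(mem_endpoints nodesN endN) => w [] /val_inj <- kv; split=> //.
  have [_ _ _ _ /(_ v d vd)->] := levelsL k kL.
  apply: eq_card => u; rewrite !inE; case: (boolP (gadj u v)) => //= uv.
  by rewrite (nodes_at_adj nodesN endN edgesE _ uv) -kv eqSS eq_sym.
have entry_ord k x : k < size Ls -> x \in (nth no_level Ls k).1 ->
    exists v, x = (val v, x.2).
  move=> kL xL; have : (x.1, k.+1) \in endpoints E' by rewrite -keyP ?map_f.
  case/(mem_endpoints nodesN endN) => w [] xw _; exists w.
  by case: x xw {xL} => a b /= ->.
have uniqL : uniq [seq x.1 | x <- level_entries Ls].
  (* Induction on the number [j] of levels taken into account; pairs from different levels differ in
     their label. *)
  rewrite /level_entries; move: (leqnn (size Ls)); move: {1 3}(size Ls) => j.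
  elim: j => [//|j IH] jL; rewrite -addn1 iotaD map_cat flatten_cat map_cat cat_uniq.
  rewrite IH ?(ltnW jL) //= add0n cats0 -map_comp; apply/andP; split.
    apply/hasPn => y /mapP[x xL ->]; apply/negP => /mapP[z /flattenP[t]].
    case/mapP => i; rewrite mem_iota add0n /= => ij -> /mapP[w _ ->] [_ /eqP].
    by rewrite gtn_eqF.
  have [_ _ Us _ _] := levelsL j jL.
  by apply: (@map_uniq _ _ fst); rewrite -map_comp.
have memN v : (val v, lab v, claimed_degree N v) \in N.
  by rewrite (mem_nodes nodesN) !eqxx.
(* The edge from a neighbour [u] one step closer has depth [lab u], so level [lab u] exists and must
   present [v]. *)
have memL v : v != groot G ->
    (val v, lab v, #|[set u | gadj u v & (lab u).+1 == lab v]|) \in level_entries Ls.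
  move=> vs; have [u uv ku] := endE v vs.
  have kL : lab u < size Ls.
    case: (adj_edge nodesN endN edgesE uv) => /depth_size;
    by rewrite /edge_depth /= -ku ?minnE; lia.
  have : val v \in [seq x.1 | x <- (nth no_level Ls (lab u)).1].
    rewrite keyP // ku -[_ \in _]/(nodes_at E' (lab v) v).
    by rewrite (@nodes_at_adj _ _ _ nodesN endN edgesE _ u) // gadj_sym.
  case/mapP => -[w d] wd /= vw; rewrite -{w}vw in wd.
  apply/mem_level_entries; exists (lab u); split=> //.
  by have [_ <-] := entry_deg v _ d kL wd.
split; split=> //.
- apply/allP => x /(mem_nodes_ord nodesN)[v ->]; apply/implyP => /= /eqP vs.
  by rewrite vs root0.
- move=> k kL; have [Lk nilL _ _ _] := levelsL k kL; split=> //.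
  apply/andP; split; apply/allP; [move=> e|move=> x xL].
    rewrite [(nth _ _ _).2]Lk mem_filter => /andP[dk eE]; rewrite /edge_ok dk /=.
    have [a [b [ee ab]]] := memE e eE; move: dk; rewrite ee /edge_depth /=.
    have := hop_distance_step (distG a) (distG b) ab.
    rewrite gadj_sym in ab; have := hop_distance_step (distG b) (distG a) ab.
    by lia.
  have [v xv] := entry_ord k x kL xL; rewrite xv in xL *.
  have [kv ->] := entry_deg v k _ kL xL; rewrite card_gt0; apply/set0Pn.
  by have [u uv uk] := parent v k (esym kv); exists u; rewrite inE uv uk kv /=.
- by rewrite perm_sym.
- apply/allP => y _ /=; apply/eqP.
  case: (boolP (y \in [seq x.1 | x <- N])) => [/(mem_node_pairs nodesN)[v ->]|yN].
    rewrite (count_endpoints nodesN endN edgesE).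
    by rewrite (count_copies_mem (uniq_node_pairs nodesN) (memN v)) (degN _ _ _ (memN v)).
  rewrite !(count_memPn _) //; first by apply: contra yN => /endN.
  by apply: contra yN => /mem_copies[x xN <-]; apply: map_f.
- apply/allP => y _ /=; apply/eqP.
  case: (boolP (y \in [seq x.1 | x <- level_entries Ls])) => [/mapP[x xL ->]|yL].
    rewrite (count_copies_mem uniqL xL); case: x xL => -[w l] d /mem_level_entries[k [kL -> wd]].
    have [v [ww]] := entry_ord k _ kL wd; rewrite /= in ww *; rewrite ww in wd *.
    have [kv ->] := entry_deg v k d kL wd.
    by rewrite kv (count_deeper nodesN endN edgesE).
  rewrite !(count_memPn _) //.
    apply/negP => yD; have [_ [v yv]] := mem_deeper nodesN endN yD.
    (* The other nodes are presented by [memL]; the root has label 0, which is no successor, and so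
       is never a deeper end. *)
    have [vs|vs] := eqVneq v (groot G); last first.
      by case/negP: yL; rewrite yv; apply: map_f (memL v vs).
    case/flattenP: yD => t /mapP[e _ ->]; rewrite yv vs root0 /deeper_ends mem_cat.
    by case/orP; case: eqP => //=; rewrite inE => + /eqP eE; rewrite -eE.
  by apply: contra yL => /mem_copies[x xN <-]; apply: map_f.
- apply: uniq_perm => //.
    apply: subseq_uniq (uniq_node_pairs nodesN); exact/map_subseq/filter_subseq.
  move=> y; apply/mapP/mapP => [[[[w l] d] /mem_level_entries[k [kL -> wd]] ->]|].
    have [v [ww]] := entry_ord k _ kL wd; rewrite /= in ww *; rewrite ww in wd *.
    have [kv _] := entry_deg v k d kL wd.
    exists (val v, lab v, claimed_degree N v); last by rewrite /= kv.
    rewrite mem_filter memN andbT /=; apply/eqP => /val_inj vs.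
    by move: kv; rewrite vs root0.
  case=> x; rewrite mem_filter => /andP[xs /(mem_nodes_ord nodesN)[v xv]] ->.
  rewrite xv in xs *; exists (val v, lab v, #|[set u | gadj u v & (lab u).+1 == lab v]|) => //.
  by apply: memL; apply: contraNneq xs => ->.
Qed.

(** The entries inject into the nodes by the fourth identity, and there are at most as many levels
    as edges because each level has an edge. *)
Lemma valid_sizes :
  [/\ size N = gnodes G, size E' = gedges G,
      size (level_entries Ls) <= gnodes G & size Ls <= gedges G].
Proof.
have [[nodesN _ levelsL] [edgesE _ _ pairsL]] := valid_locally_valid.
have sN := size_nodes nodesN; have sE : size E' = gedges G.
  by have := perm_size edgesE; rewrite !size_map.
split=> //.
  have := perm_size pairsL; rewrite !size_map => ->.
  by rewrite size_filter (leq_trans (count_size _ _)) ?sN.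
rewrite -sE /tedges size_flatten /shape -map_comp sumnE big_map.
rewrite (big_nth no_level) -[size Ls in leqLHS]subn0 -[X in X <= _]muln1.
rewrite -sum_nat_const_nat big_nat [leqRHS]big_nat.
apply: leq_sum => k /andP[_ kL]; have [_] := levelsL k kL.
by rewrite -size_eq0 lt0n.
Qed.

End Completeness.

End Transcript.

(** * A transcript of linear length *)

(** A path shortens to one without repetitions. This is what makes the labels fit into a machine
    word. *)
Lemma hop_distance_lt (T : finType) (e : rel T) (s u : T) k :
  hop_distance e s u k -> k < #|T|.
Proof.
move=> [[p [ep lp <-]] minp]; case/shortenP: ep lp => q eq Uq _ lq.
by apply: leq_ltn_trans (minp q eq lq) _; rewrite -[_.+1]/(size (s :: q)) -(card_uniqP Uq) max_card.
Qed.

Lemma perm_buckets (T : eqType) (h : T -> nat) (s : seq T) D :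
  all (fun x => h x < D) s ->
  perm_eq (flatten [seq [seq x <- s | h x == k] | k <- iota 0 D]) s.
Proof.
move=> hD; rewrite -[X in perm_eq _ X](all_filterP hD) {hD}.
elim: D => [|D IH]; first by elim: s.
rewrite -addn1 iotaD map_cat flatten_cat /= cats0 add0n.
apply/permP => p; rewrite count_cat (permP IH) !count_filter.
by elim: s {IH} => //= x s; case: (p x) => //=; lia.
Qed.

Lemma all_flatten (T : Type) (p : pred T) (ss : seq (seq T)) :
  all p (flatten ss) = all (all p) ss.
Proof. by elim: ss => //= s ss <-; rewrite all_cat. Qed.

Lemma ltn_word (m : nat) : m.+1 < 2 ^ word_size m.
Proof. exact: up_logP. Qed.

Lemma annotation_length_serialize (T : transcript) :
  annotation_length (serialize T) =
  4 * size (tnodes T) + size (tlevels T) + 3 * size (level_entries (tlevels T)) +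
  5 * size (tedges T).
Proof.
rewrite /annotation_length /serialize big_cat big_map -!(addnA (4 * _)); congr (_ + _).
  rewrite (eq_bigr (fun=> 4)) => [|[[v l] d] _ //].
  by rewrite big_const_seq count_predT iter_addn_0.
rewrite /tedges; elim/last_ind: (tlevels T) => [|Ls L IH].
  by rewrite /= big_nil.
rewrite !map_rcons !flatten_rcons big_cat {}IH level_entries_rcons !size_cat size_rcons size_map.
rewrite big_cons big_cat !big_map /=.
rewrite (eq_bigr (fun=> 3)) => [|[v d] _ //].
rewrite [in X in _ + (_ + (_ + X))](eq_bigr (fun=> 5)) => [|[[u lu] [v lv]] _ //].
rewrite !big_const_seq !count_predT !iter_addn_0.
by move: (size Ls) (size (level_entries Ls)) (size L.1) (size (flatten _)) (size L.2) => *; lia.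
Qed.

Section BFS.
Variable G : rooted_graph_stream.
Local Notation V := 'I_(gnodes G).
Implicit Types (u v w : V).
Variable f : V -> nat.
Hypothesis distG : forall v, hop_distance (@gadj G) (groot G) v (f v).

Definition labelled_stream : seq labelled_edge :=
  [seq ((val p.1, f p.1), (val p.2, f p.2)) | p <- gstream G].

Definition bfs_level (k : nat) : seq level_entry * seq labelled_edge :=
  ([seq (val v, #|[set u | gadj u v & f u == k]|) | v <- enum V & f v == k.+1],
   [seq e <- labelled_stream | edge_depth e == k]).

Definition bfs_transcript : transcript :=
  Transcript [seq (val v, f v, #|[set w | gadj v w]|) | v <- enum V]
             (mkseq bfs_level (\max_(e <- labelled_stream) (edge_depth e).+1)).

Local Notation N := (tnodes bfs_transcript).
Local Notation Ls := (tlevels bfs_transcript).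
Local Notation E' := (tedges bfs_transcript).

Lemma bfs_edges_perm : perm_eq E' labelled_stream.
Proof.
rewrite /tedges /= /mkseq -map_comp; apply: perm_buckets.
by apply/allP => e eE; apply: (@leq_bigmax_seq _ _ xpredT (fun e => (edge_depth e).+1)).
Qed.

(** No depth below the maximum is skipped: an edge of larger depth has an endpoint beyond distance
    [k]; on the way back to the root there is a node at distance [k.+1], and the edge to its
    predecessor has depth [k]. *)
Lemma bfs_depth_ex k : k < size Ls -> has (fun e => edge_depth e == k) labelled_stream.
Proof.
rewrite size_mkseq => kD.
have /hasP[e eE ke] : has (fun e => k <= edge_depth e) labelled_stream.
  apply: contraLR kD => /hasPn eE; rewrite -leqNgt.
  by apply/bigmax_leqP_seq => e /eE + _; rewrite -ltnNge.
have [ek|ek] := eqVneq (edge_depth e) k; first by apply/hasP; exists e; rewrite ?ek.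
have desc j a : j <= f a -> exists v, f v = j.
  rewrite -{1}(subnK (leqnn j)); move=> ja; move: ja; rewrite subnK //.
  move fa : (f a) => i; elim: i a fa => [|i IH] a fa; first by rewrite leqn0 => /eqP->; exists a.
  rewrite leq_eqVlt => /predU1P[->|]; first by exists a.
  have := distG a; rewrite fa => /hop_distance_pred[u _ /hop_distance_inj/(_ (distG u)) iu].
  by rewrite ltnS; apply: (IH u).
case/mapP: eE => -[a b] _ ee; rewrite ee /edge_depth /= in ke ek.
have /desc[v vk] : k.+1 <= f a by lia.
have := distG v; rewrite vk => /hop_distance_pred[u uv /hop_distance_inj/(_ (distG u)) ku].
apply/hasP; move: uv; rewrite gstream_adj => /orP[] uvG.
  by exists ((val u, f u), (val v, f v)); [apply: map_f uvG | rewrite /edge_depth /= vk -ku; lia].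
by exists ((val v, f v), (val u, f u)); [apply: map_f uvG | rewrite /edge_depth /= vk -ku; lia].
Qed.

Lemma bfs_transcript_valid : valid_augmented_transcript G bfs_transcript.
Proof.
have nodesN : [seq x.1.1 | x <- N] = iota 0 (gnodes G).
  by rewrite -map_comp -val_enum_ord; apply: eq_map.
have labN v : label N v = f v.
  have : (val v, f v, #|[set w | gadj v w]|) \in N by apply: map_f; rewrite mem_enum.
  by rewrite (mem_nodes nodesN) => /andP[/eqP].
have endN : {subset endpoints E' <= [seq x.1 | x <- N]}.
  move=> y yE; apply/(mem_node_pairs nodesN); move: yE; rewrite /endpoints mem_cat.
  case/orP => /mapP[e]; rewrite (perm_mem bfs_edges_perm) => /mapP[[a b] _ ->] ->.
    by exists a; rewrite labN.
  by exists b; rewrite labN.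
have edgesE : perm_eq [seq undirected (e.1.1, e.2.1) | e <- E'] (stream_edges G).
  rewrite (permPl (perm_map _ bfs_edges_perm)) -map_comp.
  exact: perm_refl.
have depths k : k < size Ls -> all (fun e => edge_depth e == k) (nth no_level Ls k).2.
  by rewrite size_mkseq => kD; rewrite nth_mkseq // filter_all.
have atE u v k : gadj u v -> nodes_at E' k u = (f u == k).
  by move=> uv; rewrite (nodes_at_adj nodesN endN edgesE _ uv) labN eq_sym.
split; first split.
- exact: sorted_depths depths.
- by split=> // v l d /mapP[w _ [/val_inj-> _ ->]].
- by move=> v l d /mapP[w _ [/val_inj-> -> _]].
move=> k kL; have kD := kL; rewrite size_mkseq in kD.
rewrite edges_at_level // /= nth_mkseq //; split=> //.
- by have := bfs_depth_ex kL; rewrite has_filter.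
- rewrite -map_comp map_inj_uniq; last exact: val_inj.
  by rewrite filter_uniq // enum_uniq.
- rewrite -map_comp => v; rewrite unfold_in; apply/mapP/idP => [[w]|vE].
    rewrite mem_filter => /andP[/eqP wk _] -> /=.
    have := distG w; rewrite wk => /hop_distance_pred[u uw _].
    rewrite -[X in is_true X]/(nodes_at E' k.+1 (val w)).
    by rewrite (@atE w u) ?wk // gadj_sym.
  have [w [vw kw]] := mem_endpoints nodesN endN vE.
  by exists w => //; rewrite mem_filter mem_enum kw labN eqxx.
- move=> v d /mapP[w]; rewrite mem_filter => /andP[/eqP wk _] [/val_inj <- ->].
  by apply: eq_card => u; rewrite !inE; case: (boolP (gadj u v)) => //= uv; rewrite (atE u v).
Qed.

(** Every field is a node, a distance or the size of a set of nodes, hence at most [gnodes G], which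
    is at most m + 1. *)
Lemma bfs_transcript_annotation : is_annotation (gedges G) (serialize bfs_transcript).
Proof.
have ltW k : k <= gnodes G -> k < 2 ^ word_size (gedges G).
  move=> kn; apply: leq_ltn_trans (ltn_word _).
  exact: leq_trans kn (gnodes_leq G).
have vW v : v < 2 ^ word_size (gedges G) by apply/ltW/ltnW.
have fW v : f v < 2 ^ word_size (gedges G).
  by apply/ltW/ltnW; rewrite -[X in _ < X]card_ord; apply: hop_distance_lt (distG v).
have cW (A : {set V}) : #|A| < 2 ^ word_size (gedges G).
  by apply: ltW; rewrite -[X in _ <= X]card_ord max_card.
rewrite /is_annotation /serialize all_cat all_map; apply/andP; split.
  by apply/allP => x /mapP[v _ ->] /=; rewrite vW fW cW.
rewrite all_flatten !all_map; apply/allP => k _ /=.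
rewrite all_cat !all_map; apply/andP; split; apply/allP => x /=; last first.
  by rewrite mem_filter => /andP[_ /mapP[[a b] _ ->]] /=; rewrite !vW !fW.
by move=> _; rewrite vW cW.
Qed.

End BFS.

Lemma valid_annotation_ex (G : rooted_graph_stream) :
  exists a, [/\ is_annotation (gedges G) a, valid_augmented_bfs G a &
                annotation_length a <= 13 * (gedges G + 1)].
Proof.
have [f fP] := hop_distance_ex (gadj_conn (groot G)).
have vT := bfs_transcript_valid fP; exists (serialize (bfs_transcript f)); split.
- exact: bfs_transcript_annotation.
- by exists (bfs_transcript f).
(* With n <= m + 1 nodes, the length is at most 4n + m + 3n + 5m <= 13m + 7. *)
rewrite annotation_length_serialize; have [-> -> sL sLs] := valid_sizes vT.
by have := gnodes_leq G; move: sL sLs; lia.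
Qed.

(** * The control automaton *)

(* A pair tagged with the number of the multiset identity it belongs to. *)
Definition item : Type := nat * (nat * nat).

(* [cphase] is 0 before the first level, 1 in a level that has no edge yet and
   2 in a level that has one; [clvl] counts the levels opened so far, so edges
   of depth [clvl - 1] and entries of V_[clvl] are expected; [cleft], [cright]
   are the numbers of items put into the two multisets. *)
Record ctrl := Ctrl {
  cnodes : nat; croot : nat; cphase : nat; cidx : nat; clvl : nat;
  cleft : nat; cright : nat
}.

(** The tags 0 to 3 follow the order of [multisets_match]. After k + 1 level tokens [clvl] is k + 1,
    the label of the nodes being presented. *)
Definition items_left (c : ctrl) (z : symbol) : seq item :=
  match z with
  | InputSym u v => [:: (0, undirected (u, v))]
  | AnnotationSym (NodeTok x) => nseq x.2 (1, x.1)
  | AnnotationSym (LevelEntryTok x) => (3, (x.1, clvl c)) :: nseq x.2 (2, (x.1, clvl c))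
  | _ => [::]
  end.

Definition items_right (c : ctrl) (z : symbol) : seq item :=
  match z with
  | AnnotationSym (NodeTok x) => if x.1.1 != croot c then [:: (3, x.1)] else [::]
  | AnnotationSym (EdgeTok e) =>
      [:: (0, undirected (e.1.1, e.2.1)); (1, e.1); (1, e.2)] ++
      [seq (2, y) | y <- deeper_ends e]
  | _ => [::]
  end.

(** Refusing a new level in phase 1 forces an edge into every level but the last, which is tested at
    the end of the stream. *)
Definition callowed (c : ctrl) (z : symbol) : bool :=
  match z with
  | ParamSym _ _ => false
  | InputSym _ _ => true
  | AnnotationSym (NodeTok x) =>
      [&& cphase c == 0, x.1.1 == cidx c & root_label_ok (croot c) x]
  | AnnotationSym LevelTok => cphase c != 1
  | AnnotationSym (LevelEntryTok x) => (cphase c == 1) && (0 < x.2)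
  | AnnotationSym (EdgeTok e) => (cphase c != 0) && edge_ok (clvl c).-1 e
  end.

Definition cnext (c : ctrl) (z : symbol) : ctrl :=
  let na := cleft c + size (items_left c z) in
  let nb := cright c + size (items_right c z) in
  let mk ph i l := Ctrl (cnodes c) (croot c) ph i l na nb in
  match z with
  | AnnotationSym (NodeTok _) => mk (cphase c) (cidx c).+1 (clvl c)
  | AnnotationSym LevelTok => mk 1 (cidx c) (clvl c).+1
  | AnnotationSym (EdgeTok _) => mk 2 (cidx c) (clvl c)
  | _ => mk (cphase c) (cidx c) (clvl c)
  end.

Fixpoint run_allowed (c : ctrl) (zs : seq symbol) : bool :=
  if zs is z :: zs' then callowed c z && run_allowed (cnext c z) zs' else true.

Fixpoint run_left (c : ctrl) (zs : seq symbol) : seq item :=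
  if zs is z :: zs' then items_left c z ++ run_left (cnext c z) zs' else [::].

Fixpoint run_right (c : ctrl) (zs : seq symbol) : seq item :=
  if zs is z :: zs' then items_right c z ++ run_right (cnext c z) zs' else [::].

Lemma run_allowed_cat c xs ys :
  run_allowed c (xs ++ ys) = run_allowed c xs && run_allowed (foldl cnext c xs) ys.
Proof. by elim: xs c => //= x xs IH c; rewrite IH andbA. Qed.

Lemma run_left_cat c xs ys :
  run_left c (xs ++ ys) = run_left c xs ++ run_left (foldl cnext c xs) ys.
Proof. by elim: xs c => //= x xs IH c; rewrite IH catA. Qed.

Lemma run_right_cat c xs ys :
  run_right c (xs ++ ys) = run_right c xs ++ run_right (foldl cnext c xs) ys.
Proof. by elim: xs c => //= x xs IH c; rewrite IH catA. Qed.

(** * The four identities as one *)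

Definition transcript_left (G : rooted_graph_stream) (T : transcript) : seq item :=
  [seq (0, y) | y <- stream_edges G] ++
  [seq (1, y) | y <- copies (tnodes T)] ++
  [seq (2, y) | y <- copies (level_entries (tlevels T))] ++
  [seq (3, x.1) | x <- level_entries (tlevels T)].

Definition transcript_right (G : rooted_graph_stream) (T : transcript) : seq item :=
  [seq (0, undirected (e.1.1, e.2.1)) | e <- tedges T] ++
  [seq (1, y) | y <- endpoints (tedges T)] ++
  [seq (2, y) | y <- flatten [seq deeper_ends e | e <- tedges T]] ++
  [seq (3, x.1) | x <- tnodes T & x.1.1 != groot G :> nat].

(** Filtering by the tag [k] recovers the [k]-th multiset; beyond the last tag both sides are
    empty. *)
Lemma perm_tagged (T : eqType) (s t : seq (seq T)) :
  size s = size t ->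
  perm_eq (flatten [seq [seq (k, y) | y <- nth [::] s k] | k <- iota 0 (size s)])
          (flatten [seq [seq (k, y) | y <- nth [::] t k] | k <- iota 0 (size t)]) ->
  forall k, perm_eq (nth [::] s k) (nth [::] t k).
Proof.
move=> st perm k; have [ks|ks] := ltnP k (size s); last by rewrite !nth_default -?st.
have E (u : seq (seq T)) : k < size u -> nth [::] u k =
  [seq y.2 | y <- flatten [seq [seq (k, y) | y <- nth [::] u k] | k <- iota 0 (size u)] & y.1 == k].
  move=> ku; rewrite -(cat_take_drop k (iota _ _)) (drop_nth 0) ?size_iota //.
  rewrite nth_iota // add0n map_cat flatten_cat filter_cat /= filter_cat !map_cat.
  rewrite take_iota drop_iota add0n (minn_idPl (ltnW ku)).
  have none (r : seq nat) : k \notin r ->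
      [seq y <- flatten [seq [seq (k, y) | y <- nth [::] u k] | k <- r] | y.1 == k] = [::].
    move=> kr; apply/eqP; rewrite -size_eq0 size_filter -leqn0 leqNgt -has_count.
    apply/hasPn => y /flattenP[v /mapP[j jr ->] /mapP[w _ ->]] /=.
    by apply: contraNneq kr => <-.
  rewrite !none ?mem_iota ?ltnn ?andbF ?addn1 ?add1n ?ltnn //=.
  rewrite cats0 (all_filterP _); last by apply/allP => y /mapP[w _ ->] /=.
  by rewrite -map_comp map_id.
rewrite (E s ks) (E t) -?st //; apply/perm_map/perm_filter.
by rewrite {2}st.
Qed.

Lemma multisets_matchP (G : rooted_graph_stream) (T : transcript) :
  multisets_match G T <-> perm_eq (transcript_left G T) (transcript_right G T).
Proof.
pose l := [:: stream_edges G; copies (tnodes T); copies (level_entries (tlevels T));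
              [seq x.1 | x <- level_entries (tlevels T)]].
pose r := [:: [seq undirected (e.1.1, e.2.1) | e <- tedges T]; endpoints (tedges T);
              flatten [seq deeper_ends e | e <- tedges T];
              [seq x.1 | x <- tnodes T & x.1.1 != groot G :> nat]].
have -> : transcript_left G T =
    flatten [seq [seq (k, y) | y <- nth [::] l k] | k <- iota 0 (size l)].
  by rewrite /= cats0 -map_comp.
have -> : transcript_right G T =
    flatten [seq [seq (k, y) | y <- nth [::] r k] | k <- iota 0 (size r)].
  by rewrite /= cats0 -!map_comp.
split=> [[p0 p1 p2 p3]|/(@perm_tagged _ l r erefl) p].
  by rewrite /= !perm_cat // perm_map.
by split; [exact: p 0 | exact: p 1 | exact: p 2 | exact: p 3].
Qed.

(** * Unfinished transcripts and the runs of the automaton *)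

Definition phase_of (Ls : level_list) : nat :=
  if nilp Ls then 0 else if nilp (last no_level Ls).2 then 1 else 2.

Definition levels_ok (Ls : level_list) : bool :=
  all (fun k => level_ok k (nth no_level Ls k)) (iota 0 (size Ls)).

(** What the automaton has verified of an unfinished transcript: the node list may be incomplete and
    the last level may still lack its edges. *)
Definition prefix_valid (G : rooted_graph_stream) (T : transcript) : bool :=
  [&& [seq x.1.1 | x <- tnodes T] == iota 0 (size (tnodes T)),
      all (root_label_ok (groot G)) (tnodes T),
      levels_ok (tlevels T) &
      all (fun L => L.2 != [::]) (take (size (tlevels T)).-1 (tlevels T))].

Lemma levels_ok_rcons (Ls : level_list) L :
  levels_ok (rcons Ls L) = levels_ok Ls && level_ok (size Ls) L.
Proof.
rewrite /levels_ok size_rcons -addn1 iotaD all_cat /= andbT add0n.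
rewrite nth_rcons ltnn eqxx; congr (_ && _); apply: eq_in_all => k.
by rewrite mem_iota /= add0n => kL; rewrite nth_rcons kL.
Qed.

Lemma take_belast_rcons (T : Type) (s : seq T) x :
  take (size (rcons s x)).-1 (rcons s x) = s.
Proof. by rewrite size_rcons /= -cats1 take_size_cat. Qed.

(** The ways in which one token extends a transcript: nodes come before the first level, and entries
    before the first edge of their level. Runs are analysed along chains of such extensions. *)
Inductive snoc : transcript -> token -> transcript -> Prop :=
| SnocNode N x :
    snoc (Transcript N [::]) (NodeTok x) (Transcript (rcons N x) [::])
| SnocLevel N Ls :
    snoc (Transcript N Ls) LevelTok (Transcript N (rcons Ls no_level))
| SnocEntry N Ls L1 x :
    snoc (Transcript N (rcons Ls (L1, [::]))) (LevelEntryTok x)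
         (Transcript N (rcons Ls (rcons L1 x, [::])))
| SnocEdge N Ls L1 L2 e :
    snoc (Transcript N (rcons Ls (L1, L2))) (EdgeTok e)
         (Transcript N (rcons Ls (L1, rcons L2 e))).

Lemma snoc_serialize T0 t T :
  snoc T0 t T -> serialize T = rcons (serialize T0) t.
Proof.
case=> [N x|N Ls|N Ls L1 x|N Ls L1 L2 e]; rewrite /serialize /=.
- by rewrite !cats0 map_rcons.
- by rewrite map_rcons flatten_rcons catA cats1.
- by rewrite !map_rcons !flatten_rcons /= !cats0 !rcons_cat.
- by rewrite !map_rcons !flatten_rcons /= !rcons_cat /= rcons_cat.
Qed.

Lemma snoc_inv T : T = Transcript [::] [::] \/ exists T0 t, snoc T0 t T.
Proof.
case: T => N Ls; case/lastP: Ls => [|Ls [L1 L2]].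
  by case/lastP: N => [|N x]; [left|right; do 2!eexists; apply: SnocNode].
right; case/lastP: L2 => [|L2 e]; last by do 2!eexists; apply: SnocEdge.
by case/lastP: L1 => [|L1 x]; do 2!eexists; [apply: SnocLevel|apply: SnocEntry].
Qed.

Section Run.
Variable G : rooted_graph_stream.

Definition ctrl_of (T : transcript) : ctrl :=
  Ctrl (gnodes G) (groot G) (phase_of (tlevels T)) (size (tnodes T)) (size (tlevels T))
       (size (transcript_left G T)) (size (transcript_right G T)).

Lemma phase_of_rcons (Ls : level_list) L :
  phase_of (rcons Ls L) = if nilp L.2 then 1 else 2.
Proof. by rewrite /phase_of last_rcons /nilp size_rcons. Qed.

Lemma snoc_ex T0 t :
  callowed (ctrl_of T0) (AnnotationSym t) -> exists T, snoc T0 t T.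
Proof.
case: T0 => N Ls; case/lastP: Ls => [|Ls [L1 L2]]; case: t => [x||x|e] /=;
  rewrite ?phase_of_rcons /=.
- by eexists; apply: SnocNode.
- by eexists; apply: SnocLevel.
- by [].
- by [].
- by case: nilp.
- by eexists; apply: SnocLevel.
- by case: nilP => [->|] //; eexists; apply: SnocEntry.
- by eexists; apply: SnocEdge.
Qed.

Lemma snoc_left T0 t T : snoc T0 t T ->
  perm_eq (transcript_left G T)
          (transcript_left G T0 ++ items_left (ctrl_of T0) (AnnotationSym t)).
Proof.
have copies_rcons s x : copies (rcons s x) = copies s ++ nseq x.2 x.1.
  by rewrite /copies map_rcons flatten_rcons.
have copies_cat s s' : copies (s ++ s') = copies s ++ copies s'.
  by rewrite /copies map_cat flatten_cat.
case=> [N x|N Ls|N Ls L1 x|N Ls L1 L2 e]; rewrite /transcript_left /=; apply/permP => p.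
- by rewrite copies_rcons map_cat map_nseq !count_cat; lia.
- by rewrite level_entries_rcons /= !cats0.
- rewrite !level_entries_rcons size_rcons map_rcons -cats1 !catA !copies_cat !map_cat.
  by rewrite /= cats0 map_nseq !count_cat /=; lia.
- by rewrite !level_entries_rcons /= !cats0.
Qed.

Lemma snoc_right T0 t T : snoc T0 t T ->
  perm_eq (transcript_right G T)
          (transcript_right G T0 ++ items_right (ctrl_of T0) (AnnotationSym t)).
Proof.
case=> [N x|N Ls|N Ls L1 x|N Ls L1 L2 e]; rewrite /transcript_right /tedges /=; apply/permP => p.
- by rewrite filter_rcons; case: ifP => _; rewrite ?map_rcons -?cats1 ?cats0.
- by rewrite map_rcons flatten_rcons /= !cats0.
- by rewrite !map_rcons !flatten_rcons /= !cats0.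
- rewrite !map_rcons !flatten_rcons /= -rcons_cat -cats1; move: (_ ++ L2) => E'.
  rewrite /endpoints !map_cat flatten_cat !map_cat /= cats0.
  by rewrite !count_cat /= !count_cat /=; lia.
Qed.

Lemma snoc_ctrl T0 t T : snoc T0 t T -> ctrl_of T = cnext (ctrl_of T0) (AnnotationSym t).
Proof.
move=> sT; rewrite /ctrl_of (perm_size (snoc_left sT)) (perm_size (snoc_right sT)) !size_cat.
case: sT => [N x|N Ls|N Ls L1 x|N Ls L1 L2 e]; rewrite /cnext /= ?phase_of_rcons ?size_rcons //=.
by rewrite /nilp size_rcons.
Qed.

Lemma snoc_prefix_valid T0 t T : snoc T0 t T ->
  prefix_valid G T = prefix_valid G T0 && callowed (ctrl_of T0) (AnnotationSym t).
Proof.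
case=> [N x|N Ls|N Ls L1 x|N Ls L1 L2 e]; rewrite /prefix_valid /=.
- rewrite map_rcons size_rcons -addn1 iotaD cats1 eqseq_rcons add0n all_rcons !andbT.
  by lia.
- rewrite take_belast_rcons levels_ok_rcons /= andbT.
  case/lastP: Ls => [|Ls L]; first by rewrite /= !andbT.
  rewrite take_belast_rcons all_rcons phase_of_rcons.
  by rewrite -nilpE; case: nilp; rewrite /= ?andbF ?andbT.
- rewrite !take_belast_rcons !levels_ok_rcons phase_of_rcons /level_ok /= all_rcons.
  by lia.
- rewrite !take_belast_rcons !levels_ok_rcons phase_of_rcons size_rcons /level_ok /= all_rcons.
  by case: nilp; lia.
Qed.

Definition run_start : ctrl := Ctrl (gnodes G) (groot G) 0 0 0 0 0.

Definition run_symbols (a : seq token) : seq symbol :=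
  [seq InputSym (val p.1) (val p.2) | p <- gstream G] ++ [seq AnnotationSym t | t <- a].

Lemma run_symbols_rcons a t :
  run_symbols (rcons a t) = run_symbols a ++ [:: AnnotationSym t].
Proof. by rewrite /run_symbols map_rcons -cats1 catA. Qed.

Lemma run_inputs :
  [/\ run_allowed run_start (run_symbols [::]),
      foldl cnext run_start (run_symbols [::]) = ctrl_of (Transcript [::] [::]),
      run_left run_start (run_symbols [::]) = transcript_left G (Transcript [::] [::]) &
      run_right run_start (run_symbols [::]) = transcript_right G (Transcript [::] [::])].
Proof.
have run k (ps : seq ('I_(gnodes G) * 'I_(gnodes G))) :
  let zs := [seq InputSym (val p.1) (val p.2) | p <- ps] in
  let es := [seq undirected (val p.1, val p.2) | p <- ps] in
  let c := Ctrl (gnodes G) (groot G) 0 0 0 k 0 in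
  [/\ run_allowed c zs,
      foldl cnext c zs = Ctrl (gnodes G) (groot G) 0 0 0 (k + size es) 0,
      run_left c zs = [seq (0, y) | y <- es] & run_right c zs = [::]].
  elim: ps k => [|p ps IH] k /=; first by rewrite addn0.
  by rewrite /cnext /= addn1; have [-> -> -> ->] := IH k.+1; rewrite addSnnS.
rewrite /run_symbols !cats0; have [-> -> -> ->] := run 0 (gstream G).
by rewrite /ctrl_of /transcript_left /transcript_right /= !cats0 !size_map add0n.
Qed.

(** The items are determined up to permutation only, as the automaton emits them in stream order
    while the transcript groups them by identity. *)
Lemma run_serialize T :
  [/\ run_allowed run_start (run_symbols (serialize T)) = prefix_valid G T,
      foldl cnext run_start (run_symbols (serialize T)) = ctrl_of T,
      perm_eq (run_left run_start (run_symbols (serialize T))) (transcript_left G T) &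
      perm_eq (run_right run_start (run_symbols (serialize T))) (transcript_right G T)].
Proof.
(* Induction on the number of tokens, peeling off the last one with [snoc_inv]. *)
move: {2}(size _) (leqnn (size (serialize T))) => k.
elim: k T => [|k IH] T; case: (snoc_inv T) => [->|[T0 [t sT]]].
- by move=> _; have [-> -> -> ->] := run_inputs.
- by rewrite (snoc_serialize sT) size_rcons.
- by move=> _; have [-> -> -> ->] := run_inputs.
rewrite (snoc_serialize sT) size_rcons ltnS => /IH[al st le ri].
rewrite run_symbols_rcons run_allowed_cat run_left_cat run_right_cat foldl_cat.
rewrite al st /= andbT !cats0 -(snoc_prefix_valid sT) (snoc_ctrl sT); split=> //.
  by rewrite perm_sym (permPl (snoc_left sT)) perm_cat2r perm_sym.
by rewrite perm_sym (permPl (snoc_right sT)) perm_cat2r perm_sym.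
Qed.

(** Every allowed token extends the transcript parsed so far, so a stream that is never refused is a
    serialization. *)
Lemma run_parse a : run_allowed run_start (run_symbols a) -> exists T, a = serialize T.
Proof.
elim/last_ind: a => [|a t IH]; first by exists (Transcript [::] [::]).
rewrite run_symbols_rcons run_allowed_cat => /andP[/IH[T0 ->]] /=.
have [_ -> _ _] := run_serialize T0; rewrite andbT => /snoc_ex[T sT].
by exists T; rewrite (snoc_serialize sT).
Qed.

(** The two final tests supply what a prefix may lack: a phase other than 1 gives the last level an
    edge, and the index completes the node list. *)
Lemma prefix_locally_valid T :
  reflect (locally_valid G T)
    [&& prefix_valid G T, cphase (ctrl_of T) != 1 & cidx (ctrl_of T) == gnodes G].
Proof.
apply: (iffP and3P) => [[/and4P[/eqP ids rootN /allP levL nilL] ph /eqP idx]|[ids rootN levL]].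
  split=> //; first by rewrite ids -idx.
  move=> k kL; split; first by apply: levL; rewrite mem_iota.
  move: kL nilL ph; rewrite /=; case/lastP: (tlevels T) => [//|Ls L].
  rewrite take_belast_rcons size_rcons phase_of_rcons nth_rcons ltnS leq_eqVlt.
  case/predU1P => [->|kL] nilL ph; last by rewrite kL; apply: (all_nthP _ nilL).
  by rewrite ltnn eqxx -nilpE; case: nilp ph.
have sN : size (tnodes T) = gnodes G by rewrite -(size_map (fun x => x.1.1)) ids size_iota.
split; last by rewrite /= sN.
  apply/and4P; split=> //; first by rewrite ids sN.
    by apply/allP => k; rewrite mem_iota => /andP[_ /levL[]].
  apply/(all_nthP no_level) => k; rewrite size_take_min leq_min => /andP[k1 k2].
  by rewrite nth_take //; have [] := levL k k2.
rewrite /=; case/lastP: (tlevels T) levL => [//|Ls L] /(_ (size Ls)).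
rewrite size_rcons nth_rcons ltnn eqxx phase_of_rcons => /(_ (leqnn _))[_].
by rewrite -nilpE; case: nilp.
Qed.

End Run.

(** * Fingerprints and the finite machine *)

(** Elements are matched by their rank in the enumerations, which encodes any finite type in another
    one that is at least as large. *)
Definition transfer (A B : finType) (b0 : B) (a : A) : B :=
  nth b0 (enum B) (index a (enum A)).

Lemma transferK (A B : finType) (a0 : A) (b0 : B) :
  #|A| <= #|B| -> cancel (transfer b0) (@transfer B A a0).
Proof.
move=> leAB a; have aA : index a (enum A) < #|A| by rewrite cardE index_mem mem_enum.
rewrite /transfer index_uniq ?enum_uniq ?nth_index ?mem_enum //.
by rewrite -cardE (leq_trans aA).
Qed.

Section Fingerprint.
Variables (F : finFieldType) (I : eqType) (enc : I -> F).
Local Open Scope ring_scope.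

Definition fingerprint (r : F) (s : seq I) : F := \prod_(x <- s) (r - enc x).

Lemma fingerprint_cat r s t :
  fingerprint r (s ++ t) = fingerprint r s * fingerprint r t.
Proof. exact: big_cat. Qed.

Lemma fingerprint_perm r s t : perm_eq s t -> fingerprint r s = fingerprint r t.
Proof. exact: perm_big. Qed.

(** The fingerprints are values of monic polynomials whose roots are the codes. Too many agreements
    make the polynomials equal, hence also their multisets of roots, which [dec] translates back
    into items. *)
Lemma fingerprint_collisions (ok : pred I) (dec : F -> I) s t :
  {in ok, cancel enc dec} -> all ok s -> all ok t -> ~~ perm_eq s t ->
  (#|[set r | fingerprint r s == fingerprint r t]| <= maxn (size s) (size t))%N.
Proof.
move=> encK oks okt; apply: contraR; rewrite -ltnNge => ltst.
pose P u := \prod_(x <- map enc u) ('X - x%:P).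
have fpE r u : fingerprint r u = (P u).[r].
  by rewrite /P big_map horner_prod; apply: eq_bigr => x _; rewrite hornerXsubC.
have Pst : P s = P t.
  apply/eqP; rewrite -subr_eq0; apply: contraTT ltst => nz; rewrite -leqNgt cardE.
  (* The [size] of a polynomial is its degree plus one, so a nonzero difference has at most
     [maxn (size s) (size t)] roots. *)
  rewrite -ltnS (leq_trans (max_poly_roots nz _ (enum_uniq _))) //.
    apply/allP => r; rewrite mem_enum inE !fpE rootE hornerD hornerN.
    by rewrite subr_eq0.
  rewrite (leq_trans (size_polyD _ _)) // size_polyN !size_prod_XsubC !size_map.
  by rewrite maxnSS.
have K u : all ok u -> map dec (map enc u) = u.
  by move=> /allP oku; rewrite -map_comp map_id_in // => x /oku/encK.
by rewrite -(K s) // -(K t) // perm_map // prod_XsubC_eq.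
Qed.

End Fingerprint.

Definition cbounded (b : nat) (c : ctrl) : bool :=
  [&& cnodes c <= b, croot c <= b, cidx c <= b, clvl c <= b & (cleft c <= b) && (cright c <= b)].

Definition symbol_bounded (b : nat) (z : symbol) : bool :=
  match z with
  | ParamSym _ _ => false
  | InputSym u v => (u <= b) && (v <= b)
  | AnnotationSym t => all (fun x => x <= b) (token_fields t)
  end.

Definition item_bounded (b : nat) (x : item) : bool :=
  [&& x.1 < 4, x.2.1 <= b & x.2.2 <= b].

(** No counter ever decreases, so a bound that holds at the end held throughout. *)
Lemma cbounded_cnext b c z : cbounded b (cnext c z) -> cbounded b c.
Proof.
by rewrite /cbounded; case: z => [n s|u v|[x||x|e]]; move=> /= H; lia.
Qed.

Lemma cbounded_run b c zs : cbounded b (foldl cnext c zs) -> cbounded b c.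
Proof. by elim: zs c => //= z zs IH c /IH/cbounded_cnext. Qed.

Lemma phase_cnext c z : cphase c <= 2 -> cphase (cnext c z) <= 2.
Proof. by case: z => [n s|u v|[x||x|e]]. Qed.

Lemma item_bounded_step b c z : cbounded b c -> symbol_bounded b z ->
  all (item_bounded b) (items_left c z) && all (item_bounded b) (items_right c z).
Proof.
case/and5P=> _ _ _ bl _; rewrite /item_bounded.
have und u v : u <= b -> v <= b -> (minn u v <= b) && (maxn u v <= b) by lia.
have ends (e : labelled_edge) : e.1.1 <= b -> e.1.2 <= b -> e.2.1 <= b -> e.2.2 <= b ->
    all (item_bounded b) [seq (2, y) | y <- deeper_ends e].
  move=> *; apply/allP => _ /mapP[y /mem_deeper_ends ye ->].
  by rewrite /item_bounded /=; case/orP: ye => /eqP->; apply/andP.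
case: z => [n s|u v|[[[v l] d]||[v d]|[[u lu] [v lv]]]] //=.
- by case/andP=> ub vb; rewrite /= und.
- case/and4P=> vb lb _ _; rewrite all_nseq /= vb lb orbT /=.
  by case: ifP => _ //=; rewrite vb lb.
- by case/and3P=> vb _ _; rewrite all_nseq /= vb bl orbT.
- by case/and5P=> ub lub vb lvb _; rewrite und // ub lub vb lvb ends.
Qed.

Lemma item_bounded_run b c zs : cbounded b (foldl cnext c zs) ->
  all (symbol_bounded b) zs ->
  all (item_bounded b) (run_left c zs) && all (item_bounded b) (run_right c zs).
Proof.
elim: zs c => //= z zs IH c bc /andP[bz bzs].
have /andP[l r] := IH _ bc bzs; have bc' := cbounded_cnext (cbounded_run bc).
by have /andP[l' r'] := item_bounded_step bc' bz; rewrite !all_cat l l' r r'.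
Qed.

Section Machine.
Variables (b : nat) (F : finFieldType) (C : Type) (rnd : C -> F).
Hypothesis b_gt1 : 1 < b.

Definition item_box : finType := ('I_4 * ('I_b.+1 * 'I_b.+1))%type.

Definition item_enc (x : item) : F :=
  transfer (0%R : F) ((inord x.1, (inord x.2.1, inord x.2.2)) : item_box).

Definition item_dec (y : F) : item :=
  let u := transfer ((ord0, (ord0, ord0)) : item_box) y in
  (val u.1, (val u.2.1, val u.2.2)).

Lemma item_encK : #|item_box| <= #|F| -> {in item_bounded b, cancel item_enc item_dec}.
Proof.
move=> leF [t [x y]] /and3P[/= tb xb yb].
by rewrite /item_dec /item_enc transferK //= !inordK.
Qed.

Definition ctrl_box : finType := 7.-tuple 'I_b.+1.

Definition ctrl_enc (c : ctrl) : ctrl_box :=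
  [tuple inord (cnodes c); inord (croot c); inord (cphase c); inord (cidx c);
         inord (clvl c); inord (cleft c); inord (cright c)].

Definition ctrl_dec (t : ctrl_box) : ctrl :=
  let f i := val (nth ord0 t i) in Ctrl (f 0) (f 1) (f 2) (f 3) (f 4) (f 5) (f 6).

(** The largest phase is 2, which fits because [1 < b]. *)
Lemma ctrl_encK c : cbounded b c -> cphase c <= 2 -> ctrl_dec (ctrl_enc c) = c.
Proof.
case: c => n s p i l x y /and5P[/= nb sb ib lb /andP[xb yb]] pb.
by rewrite /ctrl_dec /= !inordK // ltnS (leq_trans pb).
Qed.

(* Control state, random evaluation point and the two fingerprints; [None] is
   the rejecting sink. *)
Definition machine_state : finType := option (ctrl_box * (F * F * F)).

Definition pack (c : ctrl) (r x y : F) : machine_state :=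
  if cbounded b c then Some (ctrl_enc c, (r, x, y)) else None.

(** The evaluation point is drawn from the coins of the parameter symbol and then carried in the
    state, since random bits cannot be read again. *)
Definition machine_step (q : machine_state) (z : symbol) (coins : C) : machine_state :=
  match z, q with
  | ParamSym n s, _ => pack (Ctrl n s 0 0 0 0 0) (rnd coins) 1%R 1%R
  | _, Some (t, (r, x, y)) =>
      let c := ctrl_dec t in
      if callowed c z then
        pack (cnext c z) r (x * fingerprint item_enc r (items_left c z))%R
                           (y * fingerprint item_enc r (items_right c z))%R
      else None
  | _, None => None
  end.

Definition machine_accept (q : machine_state) : bool :=
  if q is Some (t, (_, x, y)) then
    let c := ctrl_dec t in [&& cphase c != 1, cidx c == cnodes c & x == y]
  else false.

Definition final_ok (c : ctrl) : bool :=
  [&& cbounded b c, cphase c != 1 & cidx c == cnodes c].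

Definition is_param (z : symbol) : bool := if z is ParamSym _ _ then true else false.

Lemma machine_dead zs (coins : seq C) : ~~ has is_param zs ->
  foldl (fun q z => machine_step q z.1 z.2) None (zip zs coins) = None.
Proof.
elim: zs coins => [|z zs IH] [|k coins] //=.
by rewrite negb_or => /andP[zP /IH]; case: z zP => [n s|u v|t].
Qed.

(** By monotonicity of the counters, the overflow tests made at every step amount to the single test
    in [final_ok]. *)
Lemma machine_run c zs (coins : seq C) r x y :
  ~~ has is_param zs -> size zs = size coins -> cphase c <= 2 ->
  machine_accept (foldl (fun q z => machine_step q z.1 z.2) (pack c r x y) (zip zs coins)) =
  [&& run_allowed c zs, final_ok (foldl cnext c zs) &
    (x * fingerprint item_enc r (run_left c zs) ==
     y * fingerprint item_enc r (run_right c zs))%R].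
Proof.
elim: zs coins c x y => [|z zs IH] [|k coins] //= c x y.
  move=> _ _ pc; rewrite /fingerprint !big_nil !mulr1 /pack /final_ok.
  by case: ifP => bc //; rewrite /machine_accept ctrl_encK //= andbA.
rewrite negb_or => /andP[zP zsP] [sz] pc.
(* After an overflow the machine stays in the sink, and the final state is out of bounds as well. *)
have [bc|bc] := boolP (cbounded b c); last first.
  rewrite /pack (negPf bc).
  have -> : machine_step None z k = None by case: z zP {zsP}.
  rewrite machine_dead //= /final_ok; case: (boolP (cbounded _ (foldl _ _ _))); last by rewrite /= andbF.
  by move/cbounded_run/cbounded_cnext; rewrite (negPf bc).
have -> : machine_step (pack c r x y) z k = if callowed c z then
     pack (cnext c z) r (x * fingerprint item_enc r (items_left c z))%R
                        (y * fingerprint item_enc r (items_right c z))%R else None.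
  by rewrite /pack bc; case: z zP => [n s|u v|t] _ //; rewrite /machine_step ctrl_encK.
case: ifP => // _; last by rewrite machine_dead.
by rewrite IH ?phase_cnext // !fingerprint_cat !mulrA.
Qed.

Lemma machine_output n s zs k (coins : seq C) :
  ~~ has is_param zs -> size zs = size coins ->
  let c := Ctrl n s 0 0 0 0 0 in
  machine_accept (foldl (fun q z => machine_step q z.1 z.2) None
                        (zip (ParamSym n s :: zs) (k :: coins))) =
  [&& run_allowed c zs, final_ok (foldl cnext c zs) &
    fingerprint item_enc (rnd k) (run_left c zs) ==
    fingerprint item_enc (rnd k) (run_right c zs)].
Proof. by move=> zsP sz c; rewrite /= machine_run // !mul1r. Qed.

End Machine.

(** * The verifier *)

Section Verifier.
Variable m : nat.
Local Notation Q := (2 ^ word_size m).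

Lemma word_size_gt0 : 0 < word_size m.
Proof. by rewrite up_log_gt0. Qed.

Lemma exponent_gt0 : 0 < 16 * word_size m.
Proof. by rewrite muln_gt0 word_size_gt0. Qed.

Definition fp_field : finFieldType :=
  s2val (pPrimePowerField (isT : prime 2) exponent_gt0).

Lemma card_fp_field : #|fp_field| = Q ^ 16.
Proof. by rewrite (s2valP' (pPrimePowerField _ _)) mulnC expnM. Qed.

(** Large enough for every counter on valid input: the multisets then have at most 6m + 1 items,
    while m + 2 is at most [Q]. *)
Definition field_bound : nat := 8 * Q.

Definition bfs_coins : finType := (16 * word_size m).-tuple bool.

Definition coins_to_field : bfs_coins -> fp_field := transfer (0%R : fp_field).

Definition bfs_state : finType := machine_state field_bound fp_field.

Definition zero_memory : 84.-tuple 'I_Q :=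
  nseq_tuple 84 (Ordinal (expn_gt0 2 (word_size m))).

Definition bfs_verifier : verifier m :=
  @Verifier m 84 (16 * word_size m)
    (transfer zero_memory (None : bfs_state))
    (fun x z c => transfer zero_memory
       (machine_step coins_to_field (transfer (None : bfs_state) x) z c : bfs_state))
    (fun x => machine_accept (transfer (None : bfs_state) x)).

Lemma Q_gt1 : 1 < Q.
Proof. by rewrite -[1](expn0 2) ltn_exp2l // word_size_gt0. Qed.

Lemma leq_bound k : 2 ^ k <= Q ^ k.
Proof. by case: k => // k; rewrite leq_exp2r // Q_gt1. Qed.

(** As [Q] is at least 2, [8 * Q + 1 <= 16 * Q <= Q ^ 5]: a counter takes at most five words. *)
Lemma field_bound_leq : field_bound.+1 <= Q ^ 5.
Proof.
rewrite (leq_trans (_ : _ <= 2 ^ 4 * Q ^ 1)) //; last first.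
  by rewrite (expnD Q 4 1) leq_mul2r leq_bound orbT.
by rewrite /field_bound expn1; have := Q_gt1; lia.
Qed.

(** Two words for the tag and five for each component make 12, within the 16 words of a field
    element. *)
Lemma card_item_box : #|item_box field_bound| <= #|fp_field|.
Proof.
rewrite card_fp_field /item_box !card_prod !card_ord.
rewrite (leq_trans (_ : _ <= Q ^ 2 * (Q ^ 5 * Q ^ 5))) //.
  by rewrite !leq_mul ?field_bound_leq // (leq_bound 2).
by rewrite -!expnD leq_exp2l ?Q_gt1.
Qed.

Lemma card_coins : #|bfs_coins| = #|fp_field|.
Proof. by rewrite card_tuple card_bool card_fp_field mulnC expnM. Qed.

Lemma coins_to_field_inj : injective coins_to_field.
Proof.
pose k0 : bfs_coins := nseq_tuple _ true.
by apply: can_inj (transferK k0 (0%R : fp_field) _); rewrite card_coins.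
Qed.

(** The origin of 84: seven counters of five words and three field elements of 16 words take 83
    words; one more accommodates the sink. *)
Lemma card_state : #|bfs_state| <= #|{: 84.-tuple 'I_Q}|.
Proof.
rewrite card_tuple card_ord card_option card_prod card_tuple card_ord.
rewrite !card_prod !card_fp_field.
have := field_bound_leq; rewrite -(leq_exp2r _ _ (isT : 0 < 7)) -expnM => le7.
rewrite (leq_trans (_ : _ <= (Q ^ 35 * (Q ^ 16 * Q ^ 16 * Q ^ 16)).+1)) //.
  by rewrite ltnS leq_mul2r le7 orbT.
rewrite -!expnD (leq_trans (_ : _ <= Q ^ 83 * 2)) //.
  by rewrite muln2 -addnn -addn1 leq_add2l expn_gt0 ltnW ?Q_gt1.
by rewrite (expnD Q 83 1) leq_mul2l Q_gt1 orbT.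
Qed.

(** The memory is a faithful code of the machine state, and chance enters only through the first
    block of coins, [thead r]. *)
Lemma bfs_output n s zs (r : random_string bfs_verifier (ParamSym n s :: zs)) :
  ~~ has is_param zs ->
  let c := Ctrl n s 0 0 0 0 0 in
  let enc := @item_enc field_bound fp_field in
  output r =
  [&& run_allowed c zs, final_ok field_bound (foldl cnext c zs) &
    fingerprint enc (coins_to_field (thead r)) (run_left c zs) ==
    fingerprint enc (coins_to_field (thead r)) (run_right c zs)].
Proof.
move=> zsP c enc; rewrite /output.
have run q (ys : seq (symbol * bfs_coins)) :
    foldl (fun x z => vstep (v := bfs_verifier) x z.1 z.2) (transfer zero_memory (q : bfs_state)) ys =
    transfer zero_memory
      (foldl (fun q z => machine_step coins_to_field q z.1 z.2) q ys : bfs_state).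
  elim: ys q => //= y ys IH q; rewrite -IH; congr foldl.
  by rewrite transferK // card_state.
rewrite [vstart _]/= run /= transferK ?card_state //.
have [k [r' ->]] : exists k, exists r' : (size zs).-tuple bfs_coins, r = cons_tuple k r'.
  by case/tupleP: r => k r'; exists k, r'.
rewrite theadE -(@machine_output _ _ _ coins_to_field _ _ _ _ k r') ?size_tuple //.
by rewrite /field_bound; have := Q_gt1; lia.
Qed.

End Verifier.

(** An event depending on the first block of coins alone is counted by the bad values of that
    block. *)
Lemma card_thead (T : finType) n (A : {set T}) :
  #|[set r : n.+1.-tuple T | thead r \in A]| <= #|A| * #|T| ^ n.
Proof.
have -> : #|A| * #|T| ^ n = #|setX A [set: n.-tuple T]| by rewrite cardsX cardsT card_tuple.
rewrite -(card_in_imset (f := fun r => (thead r, behead_tuple r))).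
  by apply/subset_leq_card/subsetP => _ /imsetP[r + ->]; rewrite !inE andbT.
case/tupleP=> x r; case/tupleP=> y r' _ _ E; have := congr1 fst E.
have := congr1 (fun p => val p.2) E; rewrite /= !theadE => rr' ->.
by congr cons_tuple; apply: val_inj.
Qed.

Lemma cnodes_run c zs : cnodes (foldl cnext c zs) = cnodes c.
Proof. by elim: zs c => //= z zs IH c; rewrite IH; case: z => [n s|u v|[x||x|e]]. Qed.

(** The counters measure the multisets, so bounding them bounds the degrees of the fingerprint
    polynomials. *)
Lemma counts_run c zs :
  cleft (foldl cnext c zs) = cleft c + size (run_left c zs) /\
  cright (foldl cnext c zs) = cright c + size (run_right c zs).
Proof.
elim: zs c => [|z zs IH] c /=; first by rewrite !addn0.
rewrite !size_cat !addnA; have [-> ->] := IH (cnext c z).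
by case: z => [n s|u v|[x||x|e]].
Qed.

(** * Perfect completeness and soundness *)

Section Protocol.
Variables (G : rooted_graph_stream) (a : seq token).
Local Notation m := (gedges G).
Local Notation xs := (protocol_stream G a).
Local Notation zs := (run_symbols G a).
Local Notation c0 := (run_start G).
Local Notation b := (field_bound m).

Lemma no_param : ~~ has is_param zs.
Proof.
rewrite /run_symbols has_cat !has_map negb_or.
by rewrite !(eq_has (a2 := pred0)) // !has_pred0.
Qed.

(** Equal multisets have equal fingerprints at every point, so it remains to exclude an overflow. *)
Lemma bfs_complete : valid_augmented_bfs G a ->
  forall r : random_string (bfs_verifier m) xs, output r.
Proof.
case=> T aT vT r; have [lv mm] := valid_locally_valid vT.
have [sN sE sL sLs] := valid_sizes vT.
rewrite bfs_output ?no_param // -/c0; move: (coins_to_field _) => k.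
rewrite -/(run_symbols G a) aT.
have [al st le ri] := run_serialize G T.
have /and3P[pv ph idx] : [&& prefix_valid G T, cphase (ctrl_of G T) != 1 &
  cidx (ctrl_of G T) == gnodes G] by apply/prefix_locally_valid.
have ll := (multisets_matchP G T).1 mm.
rewrite al pv st /final_ok ph idx !andbT /=; apply/andP; split.
  (* There are m edges, 2m endpoints, at most 2m deeper ends and at most m + 1 nodes. *)
  have sR : size (transcript_right G T) <= 6 * m + 1.
    rewrite /transcript_right !size_cat !size_map /endpoints size_cat !size_map sE.
    have : size (flatten [seq deeper_ends e | e <- tedges T]) <= 2 * m.
      rewrite -sE; elim: (tedges T) => //= e E' IH; rewrite size_cat mulnS leq_add //.
      by rewrite /deeper_ends size_cat; do 2!case: ifP.
    have : size [seq x <- tnodes T | x.1.1 != groot G :> nat] <= gnodes G.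
      by rewrite size_filter (leq_trans (count_size _ _)) ?sN.
    by have := gnodes_leq G; lia.
  have bm : 8 * m.+2 <= b by rewrite leq_mul2l /=; apply: ltn_word.
  have bR : size (transcript_right G T) <= b by apply: leq_trans sR (leq_trans _ bm); lia.
  have nG := gnodes_leq G; have sG := ltn_ord (groot G).
  rewrite /cbounded /= (perm_size ll) sN; apply/and5P.
  by split; first [by rewrite bR | move: nG sG sLs bm => *; lia].
by apply/eqP/fingerprint_perm; rewrite (permPl le) (permPl ll) perm_sym.
Qed.

(** If a deterministic test fails, all coins reject. Otherwise the two multisets differ, and
    acceptance requires one of at most [field_bound m] collision points. *)
Lemma bfs_sound : is_annotation m a -> ~ valid_augmented_bfs G a ->
  3 * #|[set r : random_string (bfs_verifier m) xs | output r]| <=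
  #|random_string (bfs_verifier m) xs|.
Proof.
move=> annA inv; have [ok|nok] :=
  boolP (run_allowed c0 zs && final_ok b (foldl cnext c0 zs)); last first.
  rewrite (_ : [set r | _] = set0) ?cards0 //; apply/setP => r.
  rewrite !inE bfs_output ?no_param // -/c0; apply: contraNF nok.
  by case/and3P=> -> ->.
have /andP[al /and3P[bc ph idx]] := ok.
(* Were the multisets equal, the stream would parse into a transcript passing all checks, hence a
   valid one. *)
have npe : ~~ perm_eq (run_left c0 zs) (run_right c0 zs).
  apply/negP => pe; apply: inv; have [T aT] := run_parse al; exists T => //.
  have [al' st le ri] := run_serialize G T; rewrite -aT in al' st le ri.
  apply: locally_valid_sound.
    by apply/prefix_locally_valid; rewrite -al' -st al ph (eqP idx) cnodes_run /=.
  by apply/multisets_matchP; rewrite -(permPl le) (permPl pe).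
have sym_ok : all (symbol_bounded b) zs.
  have leb k : k < 2 ^ word_size m -> k <= b by rewrite /field_bound; lia.
  have lev (v : 'I_(gnodes G)) : v <= b.
    apply/leb/(leq_trans _ (ltn_word m)); rewrite ltnS ltnW //.
    exact: leq_trans (ltn_ord v) (gnodes_leq G).
  rewrite /run_symbols all_cat !all_map; apply/andP; split.
    by apply/allP => p _ /=; rewrite !lev.
  apply: sub_all annA => t /=; apply: sub_all => k; exact: leb.
have /andP[okl okr] := item_bounded_run bc sym_ok.
have encK := @item_encK (field_bound m) (fp_field m) (card_item_box m).
have := fingerprint_collisions encK okl okr npe; set A := [set _ | _] => leA.
have {}leA : #|A| <= b.
  have [szl szr] := counts_run c0 zs; have /and5P[_ _ _ _] := bc.
  by rewrite szl szr => /andP[/= bl br]; rewrite (leq_trans leA) // geq_max bl.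
pose bad := [set k | coins_to_field k \in A].
have leB : #|bad| <= b.
  rewrite (leq_trans _ leA) // -(card_imset _ (@coins_to_field_inj m)).
  by apply/subset_leq_card/subsetP => _ /imsetP[k + ->]; rewrite inE.
have -> : #|random_string (bfs_verifier m) xs| = #|fp_field m| * #|bfs_coins m| ^ size zs.
  by rewrite card_tuple /= expnS card_coins.
rewrite (leq_trans (_ : _ <= 3 * (b * #|bfs_coins m| ^ size zs))) //.
  rewrite leq_mul2l; apply/orP; right; apply: leq_trans (leq_mul leB (leqnn _)).
  apply: leq_trans (card_thead _ bad); apply/subset_leq_card/subsetP => r.
  by rewrite !in_set bfs_output ?no_param // -/c0 => /and3P[].
(* Writing [Q] for [2 ^ word_size m], [3 * (8 * Q) <= 2 ^ 5 * Q <= Q ^ 6 <= Q ^ 16]. *)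
rewrite mulnA leq_mul2r; apply/orP; right; rewrite card_fp_field.
rewrite (leq_trans (_ : _ <= 2 ^ 5 * (2 ^ word_size m) ^ 1)) //.
  by rewrite /field_bound expn1 mulnA leq_mul2r orbT.
apply: (@leq_trans ((2 ^ word_size m) ^ 6)); last by rewrite leq_exp2l ?Q_gt1.
by rewrite (expnD _ 5 1) leq_mul2r leq_bound orbT.
Qed.

End Protocol.

Theorem theorem9 :
  exists P : forall m : nat, verifier m,
    valid_protocol valid_augmented_bfs (fun m : nat => m) (fun _ : nat => 1) P.
Proof.
exists bfs_verifier.
have card0 m xs : (0 < #|random_string (bfs_verifier m) xs|)%N.
  rewrite card_tuple expn_gt0 card_tuple expn_gt0 card_bool; by [].
split.
- move=> G a annA va; rewrite /accept_prob.
  have -> : [set r : random_string (bfs_verifier (gedges G)) (protocol_stream G a) | output r] = setT.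
    by apply/setP => r; rewrite !inE bfs_complete.
  by rewrite cardsT divff // pnatr_eq0 -lt0n card0.
- move=> G a annA inv; rewrite /reject_prob.
  have := bfs_sound annA inv; set A := [set r | output r].
  rewrite (_ : [set r | ~~ _] = ~: A); last by apply/setP => r; rewrite !inE.
  move=> le3; rewrite ler_pdivrMr ?ltr0n // mulrAC ler_pdivlMr ?ltr0n ?card0 //.
  rewrite -!natrM ler_nat; have := cardsC A; lia.
(* The number of words of memory also dominates the constant 13 of the annotation length. *)
exists 84%N; split=> [G|m] /=; last by rewrite leq_pmulr.
have [a [annA va la]] := valid_annotation_ex G; exists a; split=> //.
by rewrite (leq_trans la) // leq_mul2r orbT.
Qed.
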